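(* Let $k,l$ be real numbers satisfying $0<k\le l+1$, let $1\le p<\infty$ and $m:=pk+(1-p)l$. Then $$\int_0^\infty|u'|^p\,|x|^{pk+(1-p)l}\,dx\ \ge\ \int_0^\infty|(u^* )'|^p\,|x|^{pk+(1-p)l}\,dx$$ for every $u\in W^{1,p}_{m,l}(0,\infty)$, where $u^*$ denotes the half $\mu_l$-symmetrization of $u$.
   Context: $W^{1,p}_{m,l}(0,\infty)$ is the space of (locally absolutely continuous) functions $u$ on $(0,\infty)$ with $\int_0^\infty|u|^p x^l\,dx<\infty$, $\int_0^\infty|u'|^p x^m\,dx<\infty$ and $\lim_{x\to\infty}u(x)=0$. The measure $\mu_l$ on $\mathbb{R}$ is $d\mu_l(x)=|x|^l\,dx$. For a measurable function $u$ with $\mu_l(\{y:|u(y)|>t\})<\infty$ for all $t>0$ (functions on $(0,\infty)$ being regarded as extended by zero to $\mathbb{R}$), the half $\mu_l$-symmetrization (half weighted Schwarz symmetrization) $u^*:(0,\infty)\to[0,\infty)$ is $$u^*(x)=\sup\{t\ge0:\ \mu_l(\{y\in\mathbb{R}:|u(y)|>t\})>\mu_l((0,x))\},\qquad x>0.$$ *)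

(* Defs.v *)
From HB Require Import structures.
From mathcomp Require Import all_boot all_order all_algebra.
From mathcomp Require Import all_classical all_reals all_analysis.
Set Implicit Arguments.
Unset Strict Implicit.
Unset Printing Implicit Defensive.
Import Order.TTheory GRing.Theory Num.Theory.
Import numFieldNormedType.Exports.
Local Open Scope classical_set_scope.
Local Open Scope ring_scope.

(* A function on (0, +oo) is represented by a total function R -> R; every
   definition below depends only on its values at positive points. *)

Definition abs_continuous (R : realType) (a b : R) (f : R -> R) : Prop :=
  forall e : R, 0 < e -> exists2 d : R, 0 < d &
    forall (n : nat) (x y : 'I_n -> R),
      (forall i, a <= x i /\ x i <= y i /\ y i <= b) ->
      trivIset setT (fun i => `]x i, y i[%classic) ->
      \sum_(i < n) (y i - x i) < d ->
      \sum_(i < n) `|f (y i) - f (x i)| < e.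

Definition loc_abs_continuous (R : realType) (f : R -> R) : Prop :=
  forall a b : R, 0 < a -> a <= b -> abs_continuous a b f.

(* On a locally absolutely continuous f, [derive1 f] exists
   almost everywhere and is the weak derivative; where f is not derivable,
   [derive1 f] is a junk value, on a null set. *)
Definition energy (R : realType) (p m : R) (f : R -> R) : \bar R :=
  (\int[lebesgue_measure]_(x in `]0%R, +oo[%classic)
     ((`|derive1 f x| `^ p) * (`|x| `^ m))%:E)%E.

Record in_W (R : realType) (p m l : R) (u : R -> R) : Prop := InW {
  W_loc_ac : loc_abs_continuous u ;
  W_Lp : (\int[lebesgue_measure]_(x in `]0%R, +oo[%classic)
            ((`|u x| `^ p) * (`|x| `^ l))%:E < +oo)%E ;
  W_energy : (energy p m u < +oo)%E ;
  W_lim : u x @[x --> +oo] --> (0 : R)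
}.

Definition mu (R : realType) (l : R) (A : set R) : \bar R :=
  (\int[lebesgue_measure]_(x in A) (`|x| `^ l)%:E)%E.

(* [u \_ D] is u on D and 0 elsewhere. The real-valued [sup] is the intended
   supremum: [sup set0 = 0], the supremum of the empty set in [0, +oo[, and for
   x > 0 the set is bounded above as soon as u is finite-valued and
   [mu l] of its superlevel sets is finite. *)
Definition half_symmetrization (R : realType) (l : R) (u : R -> R) (x : R) : R :=
  sup [set t : R | 0 <= t /\
    (mu l `]0%R, x[ <
     mu l [set y : R | (t < `|(u \_ `]0%R, +oo[) y|)%R])%E].

(* Main.v *)
Require Import Defs.
From HB Require Import structures.
From mathcomp Require Import all_boot all_order all_algebra.
From mathcomp Require Import all_classical all_reals all_analysis.
From mathcomp Require Import measurable_realfun.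
From mathcomp Require Import ring lra.
Set Implicit Arguments.
Unset Strict Implicit.
Unset Printing Implicit Defensive.
Import Order.TTheory GRing.Theory Num.Theory.
Import numFieldNormedType.Exports.
Local Open Scope classical_set_scope.
Local Open Scope ring_scope.

(** Write [v] for [`|u|] and [r] for its rearrangement.  The proof compares the
    two on strips: for [a < b], the set where [r b < v < r a].

    If [t < r a], the superlevel set [v > t] is heavier than [(0, a)], hence is
    not contained in it; since [v] vanishes at infinity, [v] then has to descend
    through the whole strip inside [(a, +oo)], where the weight [x `^ k] is at
    least [a `^ k] ([strip_crossing]).  Moreover the strip weighs at most as much
    as [(a, b)] ([mu_level_rearr]).  The exponent [m] is such that the tangent
    form of Young's inequality reads, for every [L >= 0],

      [p L^(p-1) |v'| x^k <= |v'|^p x^m + (p-1) L^p x^l],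

    and integrating it over the strip gives ([rearr_young])

      [p L^(p-1) a^k (r a - r b) <= energy of the strip + (p-1) L^p mu(a, b)].

    The energy of the strip is [Phi b - Phi a] for the nondecreasing function
    [Phi = energy_above], because [v' = 0] almost everywhere on a level set
    ([ae_level_derive0]), so that plateaus of [v] contribute nothing.  Disjoint
    intervals have disjoint and light strips, and the energy density is
    integrable, so [Phi] is locally absolutely continuous; taking [L = 1], so is
    [r].  At almost every [x] one may then divide by [b - a], let [b] tend to
    [a = x] and choose the best [L]: this is [|r'|^p x^m <= Phi'].  Integrating,
    the energy of [r] is at most the total increment of [Phi], which is at most
    the energy of [v], and [|v'| <= |u'|].

    The argument rests on the fundamental theorem of calculus for absolutely
    continuous functions, proved first: the variation of such a function is
    absolutely continuous too, hence the Stieltjes measure of a nondecreasing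
    absolutely continuous function is dominated by the Lebesgue measure; its
    Radon-Nikodym density is the derivative by Lebesgue differentiation. *)

(** * Variation of an absolutely continuous function *)

(** Arbitrary finite index types allow families that gather the points of
    several partitions. *)
Lemma abs_continuous_finType (R : realType) (a b : R) (f : R -> R) :
  abs_continuous a b f ->
  forall e : R, 0 < e -> exists2 d : R, 0 < d &
    forall (I : finType) (x y : I -> R),
      (forall i, a <= x i /\ x i <= y i /\ y i <= b) ->
      trivIset setT (fun i => `]x i, y i[%classic) ->
      \sum_i (y i - x i) < d ->
      \sum_i `|f (y i) - f (x i)| < e.
Proof.
move=> acf e e0; have [d d0 dP] := acf e e0; exists d => // I x y xy tI sI.
have := dP #|I| (x \o enum_val) (y \o enum_val) (fun i => xy _).
have sumE (F : I -> R) : \sum_(i < #|I|) F (enum_val i) = \sum_i F i.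
  by rewrite -big_enum_val.
rewrite !(sumE (fun i => y i - x i)) !(sumE (fun i => `|f (y i) - f (x i)|)).
apply => //.
apply/trivIsetP => i j _ _ ij; move/trivIsetP: tI; apply => //.
by apply: contra_neq ij; exact: enum_val_inj.
Qed.

Lemma disjoint_oo_itv (R : realType) (a b c d : R) :
  a < b -> c < d -> `]a, b[%classic `&` `]c, d[%classic = set0 ->
  b <= c \/ d <= a.
Proof.
move=> ab cd abcd; have [bc|cb] := leP b c; [by left|right].
rewrite leNgt; apply/negP => ad.
have : Num.max a c < Num.min b d by rewrite lt_min !gt_max ab cb ad cd.
move=> /midf_lt [].
rewrite gt_max => /andP[? ?]; rewrite lt_min => /andP[? ?].
suff : (`]a, b[%classic `&` `]c, d[%classic) ((Num.max a c + Num.min b d) / 2).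
  by rewrite abcd.
by split; rewrite /= in_itv/=; apply/andP; split.
Qed.

Lemma itv_partition_nth_lt (R : realType) (a b : R) (s : seq R) (i : nat) :
  (i < size s)%N -> itv_partition a b s ->
  nth b (a :: s) i < nth b (a :: s) i.+1.
Proof. by move=> si [sa _]; exact: (pathP b sa). Qed.

Lemma itv_partition_nth_homo (R : realType) (a b : R) (s : seq R) (i j : nat) :
  (i <= j)%N -> (j <= size s)%N -> itv_partition a b s ->
  nth b (a :: s) i <= nth b (a :: s) j.
Proof.
move=> ij + abs; elim: j ij => [|j ih].
  by rewrite leqn0 => /eqP ->.
rewrite leq_eqVlt ltnS => /predU1P[->//|ij] js.
by rewrite (le_trans (ih ij (ltnW js)))// ltW// itv_partition_nth_lt.
Qed.

Section total_variation_abs_continuous.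
Context {R : realType} (a b : R) (f : R -> R).
Hypothesis acf : abs_continuous a b f.

Let near_sup (x y e : R) : x <= y -> 0 < e ->
  total_variation x y f \is a fin_num ->
  exists2 s, itv_partition x y s &
    (total_variation x y f <= (variation x y f s + e)%:E)%E.
Proof.
move=> xy e0 tvf.
have [_ [_ [s xys <-] <-]] := ub_ereal_sup_adherent e0 tvf.
rewrite -/(total_variation _ _ _) -(fineK tvf) -EFinB lte_fin => /ltW.
by rewrite lerBlDr => ?; exists s => //; rewrite fineK.
Qed.

(** Partitions of disjoint intervals form together one disjoint family, to which
    absolute continuity applies. *)
Lemma variation_abs_continuous (e : R) : 0 < e -> exists2 d : R, 0 < d &
  forall (I : finType) (x y : I -> R) (s : I -> seq R),
    (forall i, a <= x i /\ x i <= y i /\ y i <= b) ->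
    trivIset setT (fun i => `]x i, y i[%classic) ->
    (forall i, itv_partition (x i) (y i) (s i)) ->
    \sum_i (y i - x i) < d ->
    \sum_i variation (x i) (y i) f (s i) < e.
Proof.
move=> e0; have [d d0 dP] := abs_continuous_finType acf e0.
exists d => // I x y s xy tI ps xyd.
pose p i n := nth (y i) (x i :: s i) n.
pose J := {i : I & 'I_(size (s i))}.
have := dP J (fun t => p (tag t) (tagged t)) (fun t => p (tag t) (tagged t).+1).
have sumJ (F : forall i, nat -> R) :
  \sum_(t : J) F (tag t) (tagged t) = \sum_i \sum_(0 <= n < size (s i)) F i n.
  under [RHS]eq_bigr do rewrite big_mkord.
  by rewrite (sig_big_dep (fun=> true) (fun _ _ => true)).
rewrite (sumJ (fun i n => p i n.+1 - p i n)).
rewrite (sumJ (fun i n => `|f (p i n.+1) - f (p i n)|)).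
apply.
- case=> i [n nsi] /=; have [axi [xyi yib]] := xy i.
  rewrite (le_trans axi) ?(itv_partition_nth_ge _ (ps i))//; last exact: ltnW.
  by rewrite ltW ?itv_partition_nth_lt// (le_trans _ yib)// (itv_partition_nth_le _ (ps i)).
- apply/trivIsetP => -[i [n ni]] [j [m mj]] _ _ /= ij.
  have H (q q' : nat) k : (q <= q')%N -> (q' <= size (s k))%N -> p k q <= p k q'.
    by move=> ? ?; exact: itv_partition_nth_homo.
  apply/seteqP; split => // z [] /=; rewrite !in_itv/=.
  have [ijE|ijE] := eqVneq i j.
    subst j; have nm : n != m.
      by apply: contra_neq ij => nm; subst m; congr (Tagged _ _); exact: val_inj.
    move=> /andP[? ?] /andP[? ?].
    have [nlm|mln|/eqP] := ltngtP n m; last by rewrite (negbTE nm).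
      have := H n.+1 m i nlm (ltnW mj); lra.
    by have := H m.+1 n i mln (ltnW ni); lra.
  move=> /andP[z1 z2] /andP[z3 z4].
  move/trivIsetP : tI => /(_ i j Logic.I Logic.I ijE).
  move=> /seteqP[+ _] => /(_ z); apply; split; rewrite /= in_itv/=.
    rewrite (le_lt_trans _ z1) ?(itv_partition_nth_ge _ (ps i))//=; last exact: ltnW.
    by rewrite (lt_le_trans z2)// (itv_partition_nth_le _ (ps i)).
  rewrite (le_lt_trans _ z3) ?(itv_partition_nth_ge _ (ps j))//=; last exact: ltnW.
  by rewrite (lt_le_trans z4)// (itv_partition_nth_le _ (ps j)).
- rewrite (le_lt_trans _ xyd)//; apply: ler_sum => i _.
  by rewrite telescope_sumr// /p (itv_partition_nth_size _ (ps i)).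
Qed.

Lemma total_variation_fin_num : a <= b -> total_variation a b f \is a fin_num.
Proof.
move=> ab; have [d d0 dP] := variation_abs_continuous ltr01.
(* an interval shorter than [d] has variation at most 1; steps of [d / 2] then
   reach [b] from [a] *)
have short x y : a <= x -> x <= y -> y <= b -> y - x < d ->
    total_variation x y f \is a fin_num.
  move=> ax xy yb xyd; rewrite ge0_fin_numE ?total_variation_ge0//.
  apply: (@le_lt_trans _ _ 1%E); last exact: ltry.
  apply: ge_ereal_sup => _ [_ [s xys <-] <-].
  have := dP unit (fun=> x) (fun=> y) (fun=> s); rewrite !big_const card_unit/=.
  rewrite !addr0 => h; rewrite lee_fin ltW// h//.
  by apply/trivIsetP => -[] [].
have h (n : nat) : forall x, a <= x -> x <= b -> x <= a + n%:R * (d / 2) ->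
    total_variation a x f \is a fin_num.
  elim: n => [|n ih] x ax xb.
    rewrite mul0r addr0 => xa; have -> : x = a by apply/eqP; rewrite eq_le xa.
    by rewrite total_variationxx.
  rewrite -natr1 mulrDl mul1r => xn.
  have [|xn'] := leP x (a + n%:R * (d / 2)); first exact: ih.
  have an : a <= a + n%:R * (d / 2) by rewrite lerDl mulr_ge0// ltW// divr_gt0.
  rewrite (total_variationD _ an (ltW xn')) fin_numD ih//=.
    by apply: short => //; [exact: ltW|lra].
  by rewrite (le_trans (ltW xn')).
apply: (h (Num.bound ((b - a) / (d / 2)))) => //.
rewrite -lerBlDl -ler_pdivrMr ?divr_gt0// ltW// archi_boundP//.
by rewrite divr_ge0 ?subr_ge0// divr_ge0// ltW.
Qed.

Lemma total_variation_abs_continuous : a <= b ->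
  abs_continuous a b (fun x => fine (total_variation a x f)).
Proof.
move=> ab e e0; have e20 : 0 < e / 2 by rewrite divr_gt0.
have [d d0 dP] := variation_abs_continuous e20.
exists d => // n x y xy tI xyd.
have tvf z t : a <= z -> z <= t -> t <= b -> total_variation z t f \is a fin_num.
  move=> az zt tb; have := total_variation_fin_num ab.
  rewrite (total_variationD _ (le_trans az zt) tb) fin_numD => /andP[+ _].
  by rewrite (total_variationD _ az zt) fin_numD => /andP[].
(* each of the [n] variations is approximated up to [e / (2 n + 2)] *)
have en : 0 < e / (2 * n.+1%:R) by rewrite divr_gt0// mulr_gt0.
have /choice[s sP] : forall i, exists s, itv_partition (x i) (y i) s /\
    (total_variation (x i) (y i) f <= (variation (x i) (y i) f s + e / (2 * n.+1%:R))%:E)%E.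
  move=> i; have [axi [xyi yib]] := xy i.
  have [s ? ?] := near_sup xyi en (tvf _ _ axi xyi yib).
  by exists s.
have := dP _ x y s xy tI (fun i => (sP i).1) xyd.
move=> vs; apply: (@le_lt_trans _ _ (\sum_i (variation (x i) (y i) f (s i) + e / (2 * n.+1%:R)))).
  apply: ler_sum => i _; have [axi [xyi yib]] := xy i.
  rewrite (total_variationD _ axi xyi) fineD ?tvf// 1?(le_trans xyi)//.
  rewrite addrAC subrr add0r ger0_norm ?fine_ge0 ?total_variation_ge0//.
  by rewrite -lee_fin fineK ?tvf//; exact: (sP i).2.
rewrite big_split/= sumr_const card_ord -(mulr_natl _ n).
have : n%:R * (e / (2 * n.+1%:R)) <= e / 2.
  have -> : n%:R * (e / (2 * n.+1%:R)) = e / 2 * (n%:R / n.+1%:R).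
    by rewrite invfM; ring.
  by rewrite ler_piMr ?(ltW e20)// ler_pdivrMr// mul1r ler_nat.
by move=> h; rewrite [ltRHS](splitr e) ltr_leD.
Qed.

End total_variation_abs_continuous.

(** * Absolutely continuous functions have a density *)

Lemma abs_continuous_dist (R : realType) (a b : R) (f : R -> R) :
  abs_continuous a b f -> forall e : R, 0 < e -> exists2 d : R, 0 < d &
  forall x y, a <= x -> x <= b -> a <= y -> y <= b -> `|x - y| < d ->
  `|f x - f y| < e.
Proof.
move=> acf e e0; have [d d0 dP] := abs_continuous_finType acf e0; exists d => //.
have H x y : a <= x -> x <= y -> y <= b -> y - x < d -> `|f y - f x| < e.
  move=> ax xy yb xyd.
  have := dP unit (fun=> x) (fun=> y); rewrite !big_const card_unit /= !addr0.
  by apply => //; apply/trivIsetP => -[] [].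
move=> x y ax xb ay yb; have [xy|/ltW yx] := leP x y => xyd.
  by rewrite distrC H// (le_lt_trans _ xyd)// distrC ler_norm.
by rewrite H// (le_lt_trans _ xyd)// ler_norm.
Qed.

Lemma open_bounded_itv (R : realType) (a b : R) (J : set R) :
  a <= b -> open J -> is_interval J -> J `<=` `]a, b[ ->
  exists x y, [/\ a <= x, x <= y, y <= b & J = `]x, y[%classic].
Proof.
move=> ab oJ iJ Jab; have [->|/set0P[j Jj]] := eqVneq J set0.
  by exists a, a; split => //; rewrite set_itv_ge// bnd_simp ltxx.
have Jb z : J z -> a < z < b by move=> /Jab; rewrite /= in_itv.
have hs : has_sup J.
  by split; [exists j|exists b => z /Jb /andP[_ /ltW]].
have hi : has_inf J.
  by split; [exists j|exists a => z /Jb /andP[/ltW]].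
have nJ z : J z -> exists2 e, 0 < e & (J (z - e) /\ J (z + e)).
  move=> Jz; have /nbhs_ballP[e /= e0 eJ] : nbhs z J by exact: open_nbhs_nbhs.
  exists (e / 2); first by rewrite divr_gt0.
  have ee : e / 2 < e by rewrite ltr_pdivrMr// ltr_pMr// ltr1n.
  split; apply: eJ; rewrite /ball/=.
    have -> : z - (z - e / 2) = e / 2 by ring.
    by rewrite gtr0_norm ?divr_gt0.
  have -> : z - (z + e / 2) = - (e / 2) by ring.
  by rewrite normrN gtr0_norm ?divr_gt0.
exists (inf J), (sup J); split.
- by apply: lb_le_inf; [exists j|move=> z /Jb /andP[/ltW]].
- by rewrite (@le_trans _ _ j)//; [apply: ge_inf => //; case: hi|apply: ub_le_sup => //; case: hs].
- by apply: ge_sup; [exists j|move=> z /Jb /andP[_ /ltW]].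
apply/seteqP; split => z; rewrite /= in_itv/=.
  move=> /nJ[e e0 [z1 z2]]; apply/andP; split.
    by rewrite (@le_lt_trans _ _ (z - e))//; [apply: ge_inf => //; case: hi|rewrite ltrBlDr ltrDl].
  by rewrite (@lt_le_trans _ _ (z + e))//; [rewrite ltrDl|apply: ub_le_sup => //; case: hs].
move=> /andP[infz zsup]; have J0 : J !=set0 by exists j.
have [z1 Jz1 z1z] := inf_lt J0 infz; have [z2 Jz2 zz2] := sup_gt J0 zsup.
by apply: (iJ z1 z2) => //; rewrite (ltW z1z) ltW.
Qed.

Section nondecreasing_abs_continuous.
Context {R : realType} (a b : R) (f : R -> R).
Hypothesis ab : a <= b.
Hypothesis ndf : {in `[a, b] &, {homo f : x y / x <= y}}.
Hypothesis acf : abs_continuous a b f.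
Local Notation lambda := (@lebesgue_measure R).

(** Composition with [clamp] extends [f] to a continuous nondecreasing function
    on the whole line, as a Stieltjes measure requires. *)
Let clamp (x : R) := Num.max a (Num.min b x).

Let clamp_itv x : clamp x \in `[a, b].
Proof. by rewrite in_itv/= /clamp le_max lexx/= ge_max ab ge_min lexx. Qed.

Let clamp_id x : x \in `[a, b] -> clamp x = x.
Proof.
rewrite in_itv/= => /andP[ax xb].
by rewrite /clamp min_r// max_r.
Qed.

Let clamp_homo : {homo clamp : x y / x <= y}.
Proof.
move=> x y xy; rewrite /clamp ge_max le_max lexx/= le_max; apply/orP; right.
by rewrite le_min !ge_min lexx xy /= orbT.
Qed.

Let clamp_dist x y : `|clamp x - clamp y| <= `|x - y|.
Proof.
wlog xy : x y / x <= y.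
  by move=> H; have [/H//|/ltW/H] := leP x y; rewrite !(distrC x) !(distrC (clamp x)).
rewrite (distrC (clamp x)) (distrC x) !ger0_norm ?subr_ge0 ?clamp_homo//.
rewrite /clamp /Num.max /Num.min; do ?case: ifPn; rewrite -?leNgt; lra.
Qed.

Let g := f \o clamp.

Let g_nd : nondecreasing g.
Proof. by move=> x y xy; apply: ndf; rewrite ?clamp_itv// clamp_homo. Qed.

Let g_continuous : continuous g.
Proof.
move=> x; apply/cvgrPdist_lt => e e0.
have [d d0 dP] := abs_continuous_dist acf e0.
apply/nbhs_ballP; exists d => // y xyd; rewrite /g/=.
have /andP[? ?] := clamp_itv x; have /andP[? ?] := clamp_itv y.
by apply: dP => //; exact: le_lt_trans (clamp_dist _ _) xyd.
Qed.

Let G : cumulative R R :=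
  HB.pack g (isCumulative.Build R _ R g g_nd (right_continuousW g_continuous)).

Let nu : {measure set (measurableTypeR R) -> \bar R} :=
  lebesgue_stieltjes_measure G.

Let nu_itv x y : a <= x -> x <= y -> y <= b -> nu `]x, y]%classic = (f y - f x)%:E.
Proof.
move=> ax xy yb.
rewrite /nu /= /lebesgue_stieltjes_measure /measure_extension.
rewrite measurable_mu_extE/=; last exact: is_ocitv.
rewrite wlength_itv_bnd//= /g/= !clamp_id// in_itv/= ?ax ?yb ?andbT//.
  exact: le_trans xy yb.
exact: le_trans ax xy.
Qed.

Let nu_oo x y : a <= x -> x <= y -> y <= b ->
  (nu `]x, y[%classic <= (f y - f x)%:E)%E.
Proof.
move=> ax xy yb; rewrite -nu_itv//; apply: le_measure; rewrite ?inE//.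
exact: subset_itvW.
Qed.

Let nu_oo_eq : nu `]a, b[%classic = (f b - f a)%:E.
Proof.
apply/eqP; rewrite eq_le nu_oo//=.
have := ab; rewrite [a <= b]le_eqVlt => /predU1P[<-|altb].
  by rewrite subrr set_itv_ge ?bnd_simp ?ltxx// measure0.
apply/lee_addgt0Pr => e e0; have [d d0 dP] := abs_continuous_dist acf e0.
pose x := Num.max a (b - d / 2).
have ax : a <= x by rewrite le_max lexx.
have xb : x < b by rewrite gt_max altb ltrBlDr ltrDl divr_gt0.
have xd : b - x < d.
  have : b - d / 2 <= x by rewrite le_max lexx orbT.
  lra.
have fe : f b - f x < e.
  by rewrite (le_lt_trans (ler_norm _))// dP// 1?ltW// gtr0_norm ?subr_gt0.
apply: (@le_trans _ _ (nu `]a, x]%classic + e%:E)%E).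
  by rewrite nu_itv// ?(ltW xb)// -EFinD lee_fin; lra.
rewrite leeD2r//; apply: le_measure; rewrite ?inE//.
by apply: subset_itvl; rewrite bnd_simp.
Qed.

Let nuoo : (nu `]a, b[%classic < +oo)%E.
Proof. by rewrite (le_lt_trans (nu_oo _ ab _))// ltry. Qed.

Let mab : @measurable _ (measurableTypeR R) `]a, b[%classic.
Proof. exact: measurable_itv. Qed.

Let nu' : {finite_measure set (measurableTypeR R) -> \bar R} :=
  mfrestr mab nuoo.

Let nu'_dom : nu' `<< lambda.
Proof.
move=> N N0 A mA AN; have lA : lambda A = 0%E by exact: N0.
apply/eqP; rewrite eq_le measure_ge0 andbT; apply/lee_addgt0Pr => e e0.
rewrite add0e; have [d d0 dP] := abs_continuous_finType acf e0.
have [U [oU AU UA]] : exists U, [/\ open U, A `<=` U & (lambda (U `\` A) < d%:E)%E].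
  have lAoo : (lambda A < +oo)%E by rewrite lA ltry.
  exact: (lebesgue_regularity_outer mA lAoo d0).
(* the components of [V] are disjoint intervals of small total length *)
pose V := U `&` `]a, b[.
have oV : open V by apply: openI => //; exact: interval_open.
have mV : measurable V by exact: open_measurable.
pose J := open_disjoint_itv oV.
have mJ q : measurable (J q) by apply: open_measurable; exact: open_disjoint_itv_open.
have VJ : V = \bigcup_q J q by exact: open_disjoint_itv_bigcup.
have /choice[x /choice[y xyP]] : forall q, exists x y,
    [/\ a <= x, x <= y, y <= b & J q = `]x, y[%classic].
  move=> q; apply: open_bounded_itv => //.
  - exact: open_disjoint_itv_open.
  - exact: open_disjoint_itv_is_interval.
  - by apply: (@subset_trans _ V); [rewrite VJ; exact: bigcup_sup|exact: subIsetr].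
have tJ : trivIset setT J by exact: open_disjoint_itv_trivIset.
have lV : (lambda V < d%:E)%E.
  apply: le_lt_trans UA; apply: (@le_trans _ _ (lambda U)).
    by apply: le_measure; rewrite ?inE//; [exact: open_measurable|exact: subIsetl].
  have mU := open_measurable oU.
  have mUA : measurable (U `\` A) by exact: measurableD.
  by rewrite -{1}(setDUK AU) (le_trans (measureU2 _ mA mUA))//= lA add0e.
apply: (@le_trans _ _ (nu V)).
  have -> : nu' A = nu (A `&` `]a, b[) by [].
  have mAab : measurable (A `&` `]a, b[) by exact: measurableI.
  by apply: le_measure; rewrite ?inE//; exact: setSI.
rewrite VJ measure_semi_bigcup//; last by rewrite -VJ.
apply: lime_le; first exact: is_cvg_nneseries.
apply: nearW => n; rewrite big_mkord.
apply: (@le_trans _ _ (\sum_(i < n) `|f (y i) - f (x i)|)%:E).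
  rewrite -sumEFin; apply: lee_sum => i _.
  have [? ? ? ->] := xyP i; rewrite (le_trans (nu_oo _ _ _))// lee_fin ler_norm//.
rewrite lee_fin ltW// dP//.
- by move=> i; have [? ? ?] := xyP i.
- apply/trivIsetP => i j _ _ ij.
  have [_ _ _ <-] := xyP i; have [_ _ _ <-] := xyP j.
  by move/trivIsetP : tJ; apply.
rewrite -lte_fin; apply: le_lt_trans lV.
rewrite VJ measure_semi_bigcup//; last by rewrite -VJ.
apply: le_trans (nneseries_lim_ge n _) => //.
rewrite big_mkord -sumEFin; apply: lee_sum => i _.
have [_ xyi _ ->] := xyP i.
by rewrite /= lebesgue_measure_itv/= lte_fin; case: ltP => //= yxi; rewrite lee_fin subr_le0.
Qed.

(** The Stieltjes measure of [f] is dominated by the Lebesgue measure because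
    [f] is absolutely continuous, and has a density by Radon-Nikodym. *)
Lemma nondecreasing_density : exists h : R -> R,
  lambda.-integrable setT (EFin \o h) /\
  forall x, a <= x -> x <= b ->
    f x - f a = \int[lambda]_(t in `]a, x]) h t.
Proof.
pose D := Radon_Nikodym_SigmaFinite.f nu' lambda.
have Dfin t : D t \is a fin_num by exact: Radon_Nikodym_SigmaFinite.f_fin_num.
have DE : EFin \o (fine \o D) = D by apply/funext => t /=; rewrite fineK.
have iD : lambda.-integrable setT D by exact: Radon_Nikodym_SigmaFinite.f_integrable.
exists (fine \o D); split; first by rewrite DE.
move=> x ax xb; rewrite /Rintegral.
under eq_integral do rewrite fineK//.
rewrite -Radon_Nikodym_SigmaFinite.f_integral//.
rewrite /nu' /= /mfrestr /mrestr.
move: xb; rewrite le_eqVlt => /predU1P[->|xb].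
  rewrite setIidr; last exact: subset_itvW.
  by rewrite nu_oo_eq.
rewrite setIidl; first by rewrite nu_itv// ltW.
by apply: subset_itvl; rewrite bnd_simp.
Qed.

End nondecreasing_abs_continuous.

Lemma abs_continuousB (R : realType) (a b : R) (f g : R -> R) :
  abs_continuous a b f -> abs_continuous a b g -> abs_continuous a b (f \- g).
Proof.
move=> acf acg e e0; have e20 : 0 < e / 2 by rewrite divr_gt0.
have [d1 d10 P1] := acf _ e20; have [d2 d20 P2] := acg _ e20.
exists (Num.min d1 d2); first by rewrite lt_min d10.
move=> n x y xy tI; rewrite lt_min => /andP[xy1 xy2].
rewrite [ltRHS](splitr e).
apply: le_lt_trans (ltrD (P1 n x y xy tI xy1) (P2 n x y xy tI xy2)).
rewrite -big_split/=; apply: ler_sum => i _.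
have -> : f (y i) - g (y i) - (f (x i) - g (x i)) =
  (f (y i) - f (x i)) - (g (y i) - g (x i)) by ring.
exact: ler_normB.
Qed.

Section abs_continuous_density.
Context {R : realType} (a b : R) (f : R -> R).
Hypothesis ab : a <= b.
Hypothesis acf : abs_continuous a b f.
Local Notation lambda := (@lebesgue_measure R).

(** Jordan decomposition: [f] is the difference of its variation function [V]
    and of [V - f], both nondecreasing and absolutely continuous. *)
Lemma abs_continuous_density : exists h : R -> R,
  lambda.-integrable setT (EFin \o h) /\
  forall x, a <= x -> x <= b ->
    f x - f a = \int[lambda]_(t in `]a, x]) h t.
Proof.
pose V x := fine (total_variation a x f).
have tvf z t : a <= z -> z <= t -> t <= b -> total_variation z t f \is a fin_num.
  move=> az zt tb; have := total_variation_fin_num acf ab.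
  rewrite (total_variationD _ (le_trans az zt) tb) fin_numD => /andP[+ _].
  by rewrite (total_variationD _ az zt) fin_numD => /andP[].
have VB x y : a <= x -> x <= y -> y <= b -> `|f y - f x| <= V y - V x.
  move=> ax xy yb; rewrite /V (total_variationD _ ax xy) fineD ?tvf ?(le_trans xy)//.
  rewrite addrAC subrr add0r -lee_fin fineK ?tvf//.
  exact: total_variation_ge.
have acV : abs_continuous a b V by exact: total_variation_abs_continuous.
have ndV : {in `[a, b] &, {homo V : x y / x <= y}}.
  move=> x y; rewrite !in_itv/= => /andP[ax xb] /andP[ay yb] xy.
  by rewrite -subr_ge0 (le_trans _ (VB x y ax xy yb)).
have ndVf : {in `[a, b] &, {homo (V \- f) : x y / x <= y}}.
  move=> x y; rewrite !in_itv/= => /andP[ax xb] /andP[ay yb] xy.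
  by have := VB x y ax xy yb; have := ler_norm (f y - f x); lra.
have [h1 [ih1 h1E]] := nondecreasing_density ab ndV acV.
have [h2 [ih2 h2E]] := nondecreasing_density ab ndVf (abs_continuousB acV acf).
exists (fun t => h1 t - h2 t); split.
  exact: (integrableB measurableT ih1 ih2).
move=> x ax xb; rewrite RintegralB//; last 2 first.
  exact: integrableS ih1.
  exact: integrableS ih2.
by rewrite -h1E// -h2E//=; lra.
Qed.

(** Lebesgue differentiation of the indefinite integral of [h]. *)
Lemma density_ae_derive (h : R -> R) :
  lambda.-integrable setT (EFin \o h) ->
  (forall x, a <= x -> x <= b -> f x - f a = \int[lambda]_(t in `]a, x]) h t) ->
  {ae lambda, forall x, a < x < b -> derivable f x 1 /\ derive1 f x = h x}.
Proof.
move=> ih fE.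
have ihy y : lambda.-integrable [set` Interval (BRight a) (BRight y)] (EFin \o h).
  exact: integrableS ih.
have := FTC1 ihy (open_integrable_locally openT ih).
apply: filterS; first exact: (ae_filter_ringOfSetsType lambda).
move=> x H /andP[ax xb].
have [dF F'] := H ax.
have fF : \forall y \near x, \int[lambda]_(t in `]a, y]) h t + f a = f y.
  near=> y; rewrite -fE ?subrK//.
    by apply/ltW; near: y; exact: lt_nbhsr.
  by apply/ltW; near: y; exact: lt_nbhsl.
pose F y := \int[lambda]_(t in `]a, y]) h t.
have DF : is_derive x 1 F (h x).
  by apply: (DeriveDef dF); rewrite -derive1E.
have Df := near_eq_is_derive fF (is_deriveD DF (is_derive_cst (f a) x 1)).
by rewrite derive1E; case: Df => df ->; rewrite addr0.
Unshelve. all: by end_near. Qed.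

End abs_continuous_density.

Section loc_abs_continuous_density.
Context {R : realType} (f : R -> R).
Local Notation lambda := (@lebesgue_measure R).

Let exhaust (x y : R) : 0 < x -> \forall n \near \oo, n.+1%:R^-1 < x /\ y < n.+1%:R.
Proof.
move=> x0; near=> n; split.
  by near: n; exact: near_infty_natSinv_lt (PosNum x0).
rewrite (@lt_le_trans _ _ n%:R) ?ler_nat//.
by near: n; exact: nbhs_infty_gtr.
Unshelve. all: by end_near. Qed.

(** On each interval from [1/(n+1)] to [n+1] there is a density, equal to the
    derivative almost everywhere; these are glued into one measurable function. *)
Lemma loc_abs_continuous_density : loc_abs_continuous f ->
  exists h : R -> R, [/\ measurable_fun setT h,
    {ae lambda, forall x, 0 < x -> derivable f x 1 /\ derive1 f x = h x} &
    forall a b, 0 < a -> a <= b ->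
      lambda.-integrable `]a, b]%classic (EFin \o h) /\
      f b - f a = \int[lambda]_(t in `]a, b]) h t].
Proof.
move=> acf.
have Sinv n : n.+1%:R^-1 <= n.+1%:R :> R.
  by rewrite (@le_trans _ _ 1)// ?invf_le1// ?ler1n.
have /choice[g gP] : forall n, exists g : R -> R,
    lambda.-integrable setT (EFin \o g) /\
    forall x, n.+1%:R^-1 <= x -> x <= n.+1%:R ->
    f x - f n.+1%:R^-1 = \int[lambda]_(t in `]n.+1%:R^-1, x]) g t.
  move=> n; apply: abs_continuous_density => //.
  by apply: acf.
have aeg : {ae lambda, forall x n, n.+1%:R^-1 < x < n.+1%:R ->
    derivable f x 1 /\ derive1 f x = g n x}.
  apply: ae_foralln => n; have [ig gE] := gP n.
  exact: (density_ae_derive ig gE).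
(* at almost every [x] the sequence [g n x] is eventually constant *)
pose H x := limn_esup (fun n => (g n x)%:E).
pose h := fine \o H.
have mg n : measurable_fun setT (g n).
  by have [/integrableP[/measurable_EFinP + _] _] := gP n.
have mH : measurable_fun setT H.
  by apply: measurable_fun_limn_esup => n; exact/measurable_EFinP.
have mh : measurable_fun setT h by apply: measurableT_comp.
have aeh : {ae lambda, forall x, 0 < x -> derivable f x 1 /\ derive1 f x = h x}.
  apply: filterS aeg; first exact: (ae_filter_ringOfSetsType lambda).
  move=> x xP x0.
  have [N _ NP] := exhaust x x0.
  have /xP[df f'E] : N.+1%:R^-1 < x < N.+1%:R by apply/andP; apply: NP => /=.
  have gx : (g n x)%:E @[n --> \oo] --> (derive1 f x)%:E.
    apply: cvg_near_cst; near=> n.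
    have /xP[_ ->//] : n.+1%:R^-1 < x < n.+1%:R.
    by apply/andP; near: n; exact: exhaust.
  split => //; rewrite /h/= /H is_cvg_limn_esupE; last by apply/cvg_ex; exists (derive1 f x)%:E.
  by rewrite (cvg_lim _ gx).
exists h; split => // a b a0 ab.
have [N _ /(_ N (leqnn _))[Na bN]] := exhaust b a0.
have [ig gE] := gP N.
have hg : ae_eq lambda `]a, b]%classic h (g N).
  apply: filterS2 aeg aeh; first exact: (ae_filter_ringOfSetsType lambda).
  move=> x xg xh; rewrite /= in_itv/= => /andP[ax xb].
  have [_ <-] := xh (lt_trans a0 ax).
  by have [] // := xg N; rewrite (lt_trans Na)// (le_lt_trans xb).
have igab : lambda.-integrable `]a, b]%classic (EFin \o g N) by exact: integrableS ig.
have mhab : measurable_fun `]a, b]%classic (EFin \o h).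
  by apply/measurable_EFinP; exact: measurable_funTS.
have mgab : measurable_fun `]a, b]%classic (EFin \o g N).
  by apply/measurable_EFinP; exact: measurable_funTS.
split.
  apply/integrableP; split => //.
  move/integrableP : igab => [_]; apply: le_lt_trans.
  rewrite le_eqVlt; apply/orP; left; apply/eqP.
  apply: ge0_ae_eq_integral => //.
  - by apply: measurableT_comp.
  - by apply: measurableT_comp.
  - by apply: filterS hg => x hgx /hgx /= ->.
have -> : \int[lambda]_(t in `]a, b]) h t = \int[lambda]_(t in `]a, b]) g N t.
  rewrite /Rintegral; congr fine.
  by apply: ae_eq_integral => //; exact: ae_eq_comp hg.
have -> : f b - f a = (f b - f N.+1%:R^-1) - (f a - f N.+1%:R^-1) by ring.
rewrite !gE ?(ltW Na) ?(ltW bN) ?(le_trans ab (ltW bN)) ?(le_trans (ltW Na))//.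
rewrite Rintegral_itvB//; first exact: integrableS ig.
by rewrite bnd_simp ltW.
Unshelve. all: by end_near. Qed.

End loc_abs_continuous_density.

(** * Comparison of integrals without measurability *)

(** The integral of a nonnegative function is the supremum over the simple
    functions below it, hence is monotone even where [derive1] has values on a
    null set that destroy measurability. *)
Section ge0_integral_nonmeasurable.
Local Open Scope ereal_scope.
Context d (T : measurableType d) (R : realType).
Variable mu : {measure set T -> \bar R}.
Implicit Types (D : set T) (f g : T -> \bar R).

Lemma ge0_le_integral_mono D f g : (forall x, D x -> 0 <= f x) ->
  (forall x, D x -> f x <= g x) ->
  \int[mu]_(x in D) f x <= \int[mu]_(x in D) g x.
Proof.
move=> f0 fg; have g0 x : D x -> 0 <= g x.
  by move=> Dx; exact: le_trans (f0 x Dx) (fg x Dx).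
rewrite !ge0_integralE//; apply: le_ereal_sup => _ [h /= hf <-].
exists h => // x; apply: le_trans (hf x) _.
by apply: lee_restrict.
Qed.

Let measurable_in D (N : set T) : measurable N ->
  measurable_fun D (fun x => x \in N).
Proof.
move=> mN; have mDN : measurable_fun setT (fun x => x \in N).
  apply: (measurable_fun_bool true); rewrite setTI.
  by rewrite [X in measurable X](_ : _ = N)//; apply/seteqP; split => x;
    rewrite /preimage/=; [move/set_mem|move/mem_set].
exact: measurable_funTS.
Qed.

(** The measurable majorant [g] is raised to [+oo] on the exceptional null set,
    and then lies above [f] everywhere. *)
Lemma ae_ge0_le_integralr D f g : measurable D -> measurable_fun D g ->
  (forall x, D x -> 0 <= f x) -> (forall x, D x -> 0 <= g x) ->
  {ae mu, forall x, D x -> f x <= g x} ->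
  \int[mu]_(x in D) f x <= \int[mu]_(x in D) g x.
Proof.
move=> mD mg f0 g0 [N [mN N0 fgN]].
pose k x := if x \in N then +oo else g x.
have mk : measurable_fun D k.
  apply: measurable_fun_if => //.
    exact: measurable_in.
  exact: measurable_funS mg.
have -> : \int[mu]_(x in D) g x = \int[mu]_(x in D) k x.
  apply: ge0_ae_eq_integral => //.
    by move=> x Dx; rewrite /k; case: ifP => // _; exact: g0.
  exists N; split => // x /= /not_implyP[Dx]; rewrite /k.
  by case: ifPn => [|_ //]; rewrite inE.
apply: ge0_le_integral_mono => // x Dx; rewrite /k; case: ifPn => [_|].
  by rewrite leey.
rewrite notin_setE => xN; apply: contrapT => fg; apply: xN; apply: fgN => /=.
by apply/not_implyP.
Qed.

(** The measurable minorant [f] is lowered to [0] on the exceptional null set,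
    and then lies below [g] everywhere. *)
Lemma ae_ge0_le_integrall D f g : measurable D -> measurable_fun D f ->
  (forall x, D x -> 0 <= f x) -> (forall x, D x -> 0 <= g x) ->
  {ae mu, forall x, D x -> f x <= g x} ->
  \int[mu]_(x in D) f x <= \int[mu]_(x in D) g x.
Proof.
move=> mD mf f0 g0 [N [mN N0 fgN]].
pose k x := if x \in N then 0 else f x.
have mk : measurable_fun D k.
  apply: measurable_fun_if => //.
    exact: measurable_in.
  exact: measurable_funS mf.
have k0 x : D x -> 0 <= k x.
  by move=> Dx; rewrite /k; case: ifP => // _; exact: f0.
have -> : \int[mu]_(x in D) f x = \int[mu]_(x in D) k x.
  apply: ge0_ae_eq_integral => //.
  exists N; split => // x /= /not_implyP[Dx]; rewrite /k.
  by case: ifPn => [|_ //]; rewrite inE.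
apply: ge0_le_integral_mono => // x Dx; rewrite /k; case: ifPn => [_|].
  exact: g0.
rewrite notin_setE => xN; apply: contrapT => fg; apply: xN; apply: fgN => /=.
by apply/not_implyP.
Qed.

End ge0_integral_nonmeasurable.

(** The convex function [a `^ p] lies above its tangent at [b]; proved as Young's
    inequality for [a] and [b `^ (p - 1)]. *)
Lemma young_tangent (R : realType) (p a b : R) : 1 <= p -> 0 <= a -> 0 <= b ->
  p * b `^ (p - 1) * a <= a `^ p + (p - 1) * b `^ p.
Proof.
move=> p1 a0 b0; have p0 : 0 < p by lra.
move: p1; rewrite le_eqVlt => /predU1P[<-|p1].
  by rewrite subrr powRr0 mulr1 mul1r mul0r addr0 powRr1.
have := @conjugate_powR R a (b `^ (p - 1)) p (p / (p - 1)).
rewrite powR_ge0 -powRrM mulrCA divff ?mulr1; last lra.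
move=> /(_ a0 isT p0); rewrite divr_gt0 ?subr_gt0// => /(_ isT).
have -> : p^-1 + (p / (p - 1))^-1 = 1 by field; lra.
move=> /(_ erefl); rewrite -(ler_pM2l p0) => H.
have -> : p * b `^ (p - 1) * a = p * (a * b `^ (p - 1)) by ring.
apply: le_trans H _; rewrite le_eqVlt; apply/orP; left; apply/eqP.
field; lra.
Qed.

(** * The weight and its primitive *)

Section power_weight.
Context {R : realType} (l : R).
Hypothesis l1 : 0 < l + 1.
Local Notation lambda := (@lebesgue_measure R).

Lemma measurable_norm_powR (r : R) : measurable_fun [set: R] (fun x : R => `|x| `^ r).
Proof.
by apply: (measurableT_comp (measurable_powR r)); exact: normr_measurable.
Qed.

Lemma measurable_norm_powR_EFin (r : R) (D : set R) :
  measurable_fun D (fun x : R => (`|x| `^ r)%:E).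
Proof. by apply/measurable_EFinP/measurable_funTS; exact: measurable_norm_powR. Qed.

Definition pow_primitive (x : R) : R := (l + 1)^-1 * x `^ (l + 1).
Local Notation P := pow_primitive.

Lemma is_derive_pow_primitive (x : R) : 0 < x -> is_derive x 1 P (x `^ l).
Proof.
move=> x0; have := @is_derive1_powR R (l + 1) x x0 => d.
have /= := is_deriveZ (l + 1)^-1 d.
by rewrite addrK -[_ *: _]/(_ * _) mulKf// gt_eqF.
Qed.

Lemma mu_itv (a b : R) : 0 < a -> a <= b -> mu l `]a, b[ = (P b - P a)%:E.
Proof.
move=> a0; rewrite le_eqVlt => /predU1P[<-|ab].
  by rewrite subrr set_itv_ge ?bnd_simp ?ltxx// /mu integral_set0.
rewrite /mu; transitivity (\int[lambda]_(x in `[a, b]) (x `^ l)%:E)%E.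
  rewrite [LHS](_ : _ = \int[lambda]_(x in `]a, b[) (x `^ l)%:E)%E; last first.
    apply: eq_integral => x; rewrite inE/= in_itv/= => /andP[ax _].
    by rewrite gtr0_norm// (lt_trans a0).
  rewrite integral_itv_bndo_bndc; last first.
    by apply/measurable_EFinP/measurable_funTS; exact: measurable_powR.
  rewrite integral_itv_obnd_cbnd//.
  by apply/measurable_EFinP/measurable_funTS; exact: measurable_powR.
have dP x : 0 < x -> derivable P x 1.
  by move=> /is_derive_pow_primitive -[].
have cP x : 0 < x -> {for x, continuous P}.
  by move=> x0; apply: differentiable_continuous; exact/derivable1_diffP/dP.
rewrite (@continuous_FTC2 _ _ P) ?EFinB//.
- apply: derivable_within_continuous => x; rewrite in_itv/= => /andP[ax _].
  by apply: derivable_powR; rewrite in_itv/= andbT (lt_le_trans a0).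
- split.
  + by move=> x; rewrite in_itv/= => /andP[ax _]; apply: dP; exact: lt_trans ax.
  + by apply: cvg_at_right_filter; exact: cP.
  + by apply: cvg_at_left_filter; apply: cP; exact: lt_trans ab.
- move=> x; rewrite in_itv/= => /andP[ax _]; rewrite derive1E.
  by have [_ ->] := is_derive_pow_primitive (lt_trans a0 ax).
Qed.

Lemma mu_itv0 (x : R) : 0 < x -> mu l `]0, x[ = (P x)%:E.
Proof.
move=> x0; pose F n := `]x / n.+1%:R, x[%classic.
have xn n : 0 < x / n.+1%:R by rewrite divr_gt0.
have xnx n : x / n.+1%:R <= x by rewrite ler_pdivrMr// ler_peMr ?ler1n// ltW.
have FE : `]0, x[%classic = \bigcup_n F n.
  apply/seteqP; split => y /=; rewrite in_itv/=.
    move=> /andP[y0 yx].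
    have := @near_infty_natSinv_lt R (PosNum (divr_gt0 y0 x0)).
    move=> [n _ /(_ n (leqnn _))/= nP]; exists n => //=.
    by rewrite /F /= in_itv/= yx andbT -ltr_pdivlMl// mulrC.
  by move=> [n _]; rewrite /F /= in_itv/= => /andP[ny ->]; rewrite (lt_trans _ ny).
have ndF : nondecreasing_seq F.
  move=> n m nm; rewrite subsetEset; apply: subset_itvr; rewrite bnd_simp.
  by rewrite ler_pM2l// lef_pV2 ?posrE// ler_nat.
have h1 : mu l (F n) @[n --> \oo] --> mu l (\bigcup_n F n).
  apply: ge0_nondecreasing_set_cvg_integral => //.
  - by move=> n; exact: measurable_itv.
  - by move=> n; exact: measurable_norm_powR_EFin.
rewrite -FE in h1.
have h2 : mu l (F n) @[n --> \oo] --> (P x - 0)%:E.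
  rewrite (_ : (fun n => mu l (F n)) = (fun n => (P x - P (x / n.+1%:R))%:E)).
    apply: cvg_EFin; first by near=> n.
    apply: cvgB; first exact: cvg_cst.
    rewrite -(mulr0 (l + 1)^-1); apply: cvgMr.
    have /cvg_at_rightP := powR_cvg0 l1; apply; split => // .
    rewrite -(mulr0 x); apply: cvgMr.
    by apply: cvg_harmonic.
  by apply/funext => n; rewrite mu_itv.
rewrite subr0 in h2.
exact: cvg_unique h1 h2.
Unshelve. all: by end_near. Qed.

Lemma pow_primitive_lipschitz (a b : R) : 0 < a -> exists2 C : R, 0 <= C &
  forall x y, a <= x -> x <= y -> y <= b -> P y - P x <= C * (y - x).
Proof.
move=> a0; exists (a `^ l + b `^ l); first by rewrite addr_ge0 ?powR_ge0.
move=> x y ax; rewrite le_eqVlt => /predU1P[<-|xy] yb; first by rewrite !subrr mulr0.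
have x0 : 0 < x by exact: lt_le_trans ax.
have [||c] := @MVT R P (fun z => z `^ l) x y xy.
- move=> z; rewrite in_itv/= => /andP[xz _].
  by apply: is_derive_pow_primitive; exact: lt_trans xz.
- apply: derivable_within_continuous => z; rewrite in_itv/= => /andP[xz _].
  by have [] := is_derive_pow_primitive (lt_le_trans x0 xz).
rewrite in_itv/= => /andP[xc cy] ->.
rewrite ler_wpM2r ?subr_ge0 ?(ltW xy)//.
have c0 : 0 < c by exact: lt_trans xc.
have [l0|l0] := leP 0 l.
  rewrite (le_trans (_ : _ <= b `^ l)) ?lerDr ?powR_ge0//.
  by rewrite ge0_ler_powR ?nnegrE ?(ltW c0)//; lra.
rewrite (le_trans (_ : _ <= a `^ l)) ?lerDl ?powR_ge0//.
rewrite -[l]opprK !(powRN _ (- l)) lef_pV2 ?posrE ?powR_gt0//.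
by rewrite ge0_ler_powR ?nnegrE//; lra.
Qed.

End power_weight.

(** * Level sets and the rearrangement *)

Lemma loc_abs_continuous_continuous (R : realType) (f : R -> R) :
  loc_abs_continuous f -> forall x, 0 < x -> {for x, continuous f}.
Proof.
move=> acf x x0; apply/cvgrPdist_lt => e e0.
have x20 : 0 < x / 2 by rewrite divr_gt0.
have ac : abs_continuous (x / 2) (x + x / 2) f by apply: acf => //; lra.
have [d d0 dP] := abs_continuous_dist ac e0.
apply/nbhs_ballP; exists (Num.min d (x / 2)); first by rewrite /= lt_min d0.
move=> y; rewrite /ball/= lt_min => /andP[xyd]; rewrite ltr_norml => /andP[? ?].
by apply: dP => //; lra.
Qed.

Section rearrangement.
Context {R : realType} (l : R) (v : R -> R).
Hypothesis l1 : 0 < l + 1.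
Hypothesis acv : loc_abs_continuous v.
Hypothesis vy : v x @[x --> +oo] --> (0 : R).
Local Notation lambda := (@lebesgue_measure R).
Local Notation P := (pow_primitive l).

Definition level (I : interval R) : set R := `]0, +oo[ `&` v @^-1` [set` I].

Definition rearr (x : R) : R :=
  sup [set t : R | 0 <= t /\ (mu l `]0%R, x[ < mu l (level `]t, +oo[))%E].

Let cv x : 0 < x -> {for x, continuous v}.
Proof. exact: loc_abs_continuous_continuous. Qed.

Let cvW a b : 0 < a -> {within `[a, b], continuous v}.
Proof.
move=> a0; apply: continuous_in_subspaceT => x; rewrite inE/= in_itv/= => /andP[ax _].
by apply: cv; exact: lt_le_trans ax.
Qed.

Lemma measurable_level I : measurable (level I).
Proof.
have mv : measurable_fun (`]0, +oo[%classic : set R) v.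
  apply: open_continuous_measurable_fun; first exact: interval_open.
  by move=> x; rewrite inE/= in_itv/= andbT; exact: cv.
exact: mv.
Qed.

Lemma level_sub (I J : interval R) : {subset I <= J} -> level I `<=` level J.
Proof. by move=> IJ x [x0 /= vx]; split => //=; exact: IJ. Qed.

Lemma mu_ge0 A : (0 <= mu l A)%E.
Proof. by apply: integral_ge0 => x _; rewrite lee_fin powR_ge0. Qed.

Lemma le_mu A B : measurable A -> measurable B -> A `<=` B -> (mu l A <= mu l B)%E.
Proof.
move=> mA mB AB; apply: ge0_subset_integral => //.
  exact: measurable_norm_powR_EFin.
Qed.

Let superlevel_le s t : s <= t -> (mu l (level `]t, +oo[) <= mu l (level `]s, +oo[))%E.
Proof.
move=> st; apply: le_mu; [exact: measurable_level..|apply: level_sub].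
by move=> x; rewrite !in_itv/= !andbT; exact: le_lt_trans.
Qed.

(** A superlevel set heavier than [(0, a)] cannot lie inside [(0, a)]. *)
Lemma superlevel_beyond a t : 0 < a ->
  (mu l `]0%R, a[ < mu l (level `]t, +oo[))%E -> exists2 y, a <= y & t < v y.
Proof.
move=> a0; apply: contraPP => H; apply/negP; rewrite -leNgt.
apply: le_mu => //; first exact: measurable_level.
move=> y [/=]; rewrite !in_itv/= !andbT => y0 tvy; rewrite y0/= ltNge.
by apply/negP => ay; apply: H; exists y.
Qed.

(** Continuity bounds [v] on a compact interval, the limit bounds it further on.
    With [superlevel_beyond], this bounds the heights that define [rearr a]. *)
Lemma bounded_beyond a : 0 < a -> exists C, forall y, a <= y -> v y <= C.
Proof.
move=> a0; have [B [_ BP]] := cvgr_lt 0 vy _ ltr01.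
have aB : a <= Num.max a (B + 1) by rewrite le_max lexx.
have [c _ cP] := EVT_max aB (@cvW _ _ a0).
exists (Num.max 1 (v c)) => y ay; rewrite le_max.
have [yB|By] := leP y (Num.max a (B + 1)).
  by rewrite cP ?orbT// in_itv/= ay.
rewrite ltW//; apply: BP; move: By; rewrite gt_max => /andP[_]; lra.
Qed.

Local Notation S x := [set t : R | 0 <= t /\ (mu l `]0%R, x[ < mu l (level `]t, +oo[))%E].

Let S_ub a : 0 < a -> has_ubound (S a).
Proof.
move=> a0; have [C CP] := bounded_beyond a0; exists C => t [t0].
by move=> /(superlevel_beyond a0)[y ay tvy]; rewrite (le_trans (ltW tvy))// CP.
Qed.

Lemma rearr_ge0 x : 0 < x -> 0 <= rearr x.
Proof.
move=> x0; rewrite /rearr; have [->|/set0P[t St]] := eqVneq (S x) set0.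
  by rewrite sup0.
by rewrite (@le_trans _ _ t)//; [case: St|apply: ub_le_sup => //; exact: S_ub].
Qed.

Lemma lt_rearr x t : 0 < x -> 0 <= t -> t < rearr x ->
  (mu l `]0%R, x[ < mu l (level `]t, +oo[))%E.
Proof.
move=> x0 t0; have [S0|/set0P Sx] := eqVneq (S x) set0.
  by rewrite /rearr S0 sup0 ltNge t0.
by move=> /(sup_gt Sx)[s [_ Ss] ts]; rewrite (lt_le_trans Ss)// superlevel_le// ltW.
Qed.

Lemma gt_rearr x t : 0 < x -> rearr x < t ->
  (mu l (level `]t, +oo[) <= mu l `]0%R, x[)%E.
Proof.
move=> x0 xt; rewrite leNgt; apply/negP => St.
have : t <= rearr x.
  apply: ub_le_sup; first exact: S_ub.
  by split => //; rewrite (le_trans (rearr_ge0 x0))// ltW.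
by rewrite leNgt xt.
Qed.

Lemma rearr_nincr a b : 0 < a -> a <= b -> rearr b <= rearr a.
Proof.
move=> a0 ab; rewrite leNgt; apply/negP => ba.
have b0 := lt_le_trans a0 ab.
have [at_ tb] := midf_lt ba; set t := (_ / 2) in at_ tb.
have t0 : 0 <= t by rewrite (le_trans (rearr_ge0 a0))// ltW.
have := lt_le_trans (lt_rearr b0 t0 tb) (gt_rearr a0 at_).
rewrite ltNge; apply/negP; rewrite negbK; apply: le_mu => //.
by apply: subset_itvl; rewrite bnd_simp.
Qed.

Let mu_level_diff s t : s <= t ->
  mu l (level `]s, +oo[) = (mu l (level `]s, t]) + mu l (level `]t, +oo[))%E.
Proof.
move=> st.
have -> : level `]s, +oo[ = level `]s, t] `|` level `]t, +oo[.
  apply/seteqP; split => x.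
    move=> [x0 /=]; rewrite in_itv/= andbT => sv; have [vt|tv] := leP (v x) t.
      by left; split => //=; rewrite in_itv/= sv.
    by right; split => //=; rewrite in_itv/= tv.
  by case=> -[x0 /=]; rewrite in_itv/=; split => //=; rewrite in_itv/=; lra.
apply: ge0_integral_setU => //.
- exact: measurable_level.
- exact: measurable_level.
- exact: measurable_norm_powR_EFin.
- apply/disj_setPS => x [[_ /=]]; rewrite in_itv/= => /andP[_ xt] [_ /=].
  by rewrite in_itv/= andbT ltNge xt.
Qed.

(** [rearr] splits heights into those whose superlevel set is heavier than
    [(0, a)] and those whose superlevel set is at most as heavy as [(0, b)]; the
    strip is the difference. *)
Lemma mu_level_le a b s t : 0 < a -> a <= b -> rearr b < s -> s <= t -> t < rearr a ->
  (mu l (level `]s, t]) <= (P b - P a)%:E)%E.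
Proof.
move=> a0 ab bs st ta; have b0 := lt_le_trans a0 ab.
have s0 : 0 <= s by rewrite (le_trans (rearr_ge0 b0))// ltW.
have := gt_rearr b0 bs; rewrite (mu_level_diff st) mu_itv0//.
have := lt_rearr a0 (le_trans s0 st) ta; rewrite mu_itv0//.
have := mu_ge0 (level `]s, t]).
case: (mu l (level `]s, t])) => [x||//]; case: (mu l (level `]t, +oo[)) => [y||] //=.
by rewrite -EFinD !lee_fin lte_fin; lra.
Qed.

(** [v] exceeds [t] somewhere beyond [a] and tends to [0], so it crosses the
    strip beyond [a]. *)
Lemma strip_crossing a s t : 0 < a -> 0 < s -> s < t -> t < rearr a ->
  exists c d, [/\ a <= c, c <= d, v c = t, v d = s &
    `]c, d[ `<=` level `]s, t] ].
Proof.
move=> a0 s0 st ta.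
have [y ay ty] := superlevel_beyond a0 (lt_rearr a0 (ltW (lt_trans s0 st)) ta).
have [B [_ BP]] := cvgr_lt 0 vy _ s0.
pose z := Num.max y (B + 1).
have yz : y <= z by rewrite le_max lexx.
have Bz : B + 1 <= z by rewrite le_max lexx orbT.
have vz : v z < s by apply: BP; lra.
have y0 := lt_le_trans a0 ay.
(* [c] is the last time before [z] at which [v] is at least [t], and
   [d] the first time after [c] at which it is at most [s] *)
pose C := [set x | y <= x <= z /\ t <= v x].
have hC : has_sup C.
  by split; [exists y; split; [rewrite lexx|exact: ltW]|exists z => x [/andP[]]].
pose c := sup C.
have yc : y <= c by apply: ub_le_sup; [case: hC|split; [rewrite lexx|exact: ltW]].
have cz : c <= z by apply: ge_sup => [|x [/andP[]]//]; case: hC.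
have c0 := lt_le_trans y0 yc.
have after_c x : c < x -> x <= z -> v x < t.
  move=> cx xz; rewrite ltNge; apply/negP => tx.
  suff : x <= c by rewrite leNgt cx.
  by apply: ub_le_sup; [case: hC|split => //; rewrite xz andbT (le_trans yc)// ltW].
have tc : t <= v c.
  rewrite leNgt; apply/negP => ct.
  have /nbhs_ballP[e /= e0 eP] : nbhs c [set y | v y < t].
    exact: (cvgr_lt _ (cv c0) _ ct).
  have [x Cx ex] := sup_adherent e0 hC.
  have xc : x <= c by apply: ub_le_sup => //; case: hC.
  have : v x < t.
    by apply: eP; rewrite /ball/= ger0_norm ?subr_ge0// ltrBlDr -ltrBlDl.
  by rewrite ltNge; case: Cx => _ ->.
have cltz : c < z.
  by rewrite lt_neqAle cz andbT; apply: contraTneq tc => ->; rewrite -ltNge (lt_trans vz).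
have vct : v c = t.
  apply/eqP; rewrite eq_le tc andbT leNgt; apply/negP => tvc.
  have /nbhs_ballP[e /= e0 eP] : nbhs c [set y | t < v y].
    exact: (cvgr_gt _ (cv c0) _ tvc).
  pose x := Num.min (c + e / 2) z.
  have cx : c < x by rewrite lt_min cltz andbT ltrDl divr_gt0.
  have : t < v x.
    apply: eP; rewrite /ball/= distrC ger0_norm ?subr_ge0 ?(ltW cx)//.
    have : x <= c + e / 2 by rewrite ge_min lexx.
    lra.
  by rewrite ltNge ltW// after_c// ge_min lexx orbT.
pose D := [set x | c <= x <= z /\ v x <= s].
have hD : has_inf D.
  by split; [exists z; split; [rewrite lexx cz|exact: ltW]|exists c => x [/andP[]]].
pose d := inf D.
have cd : c <= d by apply: lb_le_inf => [|x [/andP[]]//]; case: hD.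
have dz : d <= z by apply: ge_inf; [case: hD|split; [rewrite lexx cz|exact: ltW]].
have d0 := lt_le_trans c0 cd.
have before_d x : c <= x -> x < d -> s < v x.
  move=> cx xd; rewrite ltNge; apply/negP => sx.
  suff : d <= x by rewrite leNgt xd.
  by apply: ge_inf; [case: hD|split => //; rewrite cx (le_trans (ltW xd))].
have sd : v d <= s.
  rewrite leNgt; apply/negP => ds.
  have /nbhs_ballP[e /= e0 eP] : nbhs d [set y | s < v y].
    exact: (cvgr_gt _ (cv d0) _ ds).
  have [x Dx ex] := inf_adherent e0 hD.
  have dx : d <= x by apply: ge_inf => //; case: hD.
  have : s < v x.
    by apply: eP; rewrite /ball/= distrC ger0_norm ?subr_ge0// ltrBlDl.
  by rewrite ltNge; case: Dx => _ ->.
have cltd : c < d.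
  by rewrite lt_neqAle cd andbT; apply: contraTneq sd => <-; rewrite -ltNge vct.
have vds : v d = s.
  apply/eqP; rewrite eq_le sd/= leNgt; apply/negP => vds.
  have /nbhs_ballP[e /= e0 eP] : nbhs d [set y | v y < s].
    exact: (cvgr_lt _ (cv d0) _ vds).
  pose x := Num.max (d - e / 2) c.
  have xd : x < d by rewrite gt_max cltd andbT ltrBlDr ltrDl divr_gt0.
  have : v x < s.
    apply: eP; rewrite /ball/= ger0_norm ?subr_ge0 ?(ltW xd)//.
    have : d - e / 2 <= x by rewrite le_max lexx.
    lra.
  by rewrite ltNge ltW// before_d// le_max lexx orbT.
exists c, d; split => //; first exact: le_trans yc.
move=> x; rewrite /= in_itv/= => /andP[cx xd]; split => /=; rewrite in_itv/=.
  by rewrite andbT (lt_trans c0).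
by rewrite before_d ?(ltW cx)//= ltW// after_c// (le_trans (ltW xd)).
Qed.

End rearrangement.

(** * Decrease of the rearrangement *)

Section strip.
Context {R : realType} (l : R) (v f : R -> R).
Hypothesis l1 : 0 < l + 1.
Hypothesis acv : loc_abs_continuous v.
Hypothesis vy : v x @[x --> +oo] --> (0 : R).
Hypothesis mf : measurable_fun setT f.
Local Notation lambda := (@lebesgue_measure R).
Hypothesis fE : forall a b, 0 < a -> a <= b ->
  lambda.-integrable `]a, b]%classic (EFin \o f) /\
  v b - v a = \int[lambda]_(t in `]a, b]) f t.
Local Notation P := (pow_primitive l).
Local Notation rearr := (rearr l v).
Local Notation level := (level v).

Let measurable_normf (D : set R) : measurable_fun D (fun x => (`|f x|)%:E).
Proof.
apply/measurable_EFinP/measurable_funTS.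
exact: (measurableT_comp (@normr_measurable R setT) mf).
Qed.

Let increment_le a b : 0 < a -> a <= b ->
  (`|v b - v a|%:E <= \int[lambda]_(x in `]a, b[) (`|f x|)%:E)%E.
Proof.
move=> a0 ab; have [/integrableP[mfab _] ->] := fE a0 ab.
have -> := @integral_itv_bndo_bndc R (BRight a) b (fun x => (`|f x|)%:E)
  (@measurable_normf _).
rewrite EFin_normr_Rintegral//; last by have [] := fE a0 ab.
exact: le_abse_integral.
Qed.

(** The pointwise bound [fh] stands for any instance of Young's inequality. *)
Section majorant.
Variables (k c : R) (h : R -> \bar R).
Hypothesis k0 : 0 <= k.
Hypothesis c0 : 0 <= c.
Hypothesis mh : measurable_fun setT h.
Hypothesis h0 : forall x, (0 <= h x)%E.
Hypothesis fh : forall x, 0 < x ->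
  ((`|f x| * x `^ k)%:E <= h x + (c * x `^ l)%:E)%E.

Let measurable_cw (D : set R) :
  measurable_fun D (fun z : R => (c * `|z| `^ l)%:E).
Proof.
apply/measurable_EFinP/measurable_funM => //.
by apply: measurable_funTS; exact: measurable_norm_powR.
Qed.

(** The crossing costs at least [(t - s)] in [|v'|] at points where
    [a `^ k <= x `^ k]. *)
Lemma strip_estimate a b s t : 0 < a -> a <= b ->
  rearr b < s -> s < t -> t < rearr a ->
  ((a `^ k * (t - s))%:E <=
    \int[lambda]_(x in level `]s, t]) h x + (c * (P b - P a))%:E)%E.
Proof.
move=> a0 ab bs st ta; have b0 := lt_le_trans a0 ab.
have s0 : 0 < s by rewrite (le_lt_trans (rearr_ge0 l acv vy b0)).
have [x [y [ax xy vx vY xyL]]] := strip_crossing acv vy a0 s0 st ta.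
have x0 := lt_le_trans a0 ax.
have mL : measurable (level `]s, t]) by exact: measurable_level.
have mhD (D : set R) : measurable_fun D h by exact: measurable_funTS.
have ts : (t - s)%:E = (`|v y - v x|)%:E.
  by rewrite vx vY distrC gtr0_norm ?subr_gt0.
rewrite EFinM ts.
apply: (@le_trans _ _ ((a `^ k)%:E * \int[lambda]_(z in `]x, y[) (`|f z|)%:E)%E).
  by rewrite lee_wpmul2l ?lee_fin ?powR_ge0// increment_le.
rewrite -ge0_integralZl//; last 2 first.
  exact: (@measurable_normf _).
  by rewrite lee_fin powR_ge0.
apply: (@le_trans _ _ (\int[lambda]_(z in level `]s, t]) (h z + (c * `|z| `^ l)%:E))%E).
  apply: (@le_trans _ _ (\int[lambda]_(z in `]x, y[) (h z + (c * `|z| `^ l)%:E))%E).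
    apply: ge0_le_integral_mono => z /=; rewrite in_itv/= => /andP[xz zy].
      by rewrite -EFinM lee_fin mulr_ge0// powR_ge0.
    have z0 := lt_trans x0 xz.
    rewrite (gtr0_norm z0); apply: le_trans (fh z0).
    rewrite -EFinM lee_fin mulrC ler_wpM2l// ge0_ler_powR// ?nnegrE ?ltW//.
    exact: le_lt_trans xz.
  apply: ge0_subset_integral => //.
    by apply: emeasurable_funD; [exact: (@mhD _)|exact: (@measurable_cw _)].
  by move=> z _; rewrite adde_ge0// lee_fin mulr_ge0// powR_ge0.
rewrite ge0_integralD//; last 3 first.
  exact: (@mhD _).
  by move=> z _; rewrite lee_fin mulr_ge0// powR_ge0.
  exact: (@measurable_cw _).
rewrite leeD2l//; under eq_integral do rewrite EFinM.
rewrite ge0_integralZl//; last exact: (@measurable_norm_powR_EFin _ _ _).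
rewrite EFinM lee_wpmul2l ?lee_fin//.
by apply: mu_level_le => //; exact: ltW.
Qed.

Lemma rearr_decrease_le a b : 0 < a -> a <= b ->
  ((a `^ k * (rearr a - rearr b))%:E <=
    \int[lambda]_(x in level `]rearr b, rearr a[) h x + (c * (P b - P a))%:E)%E.
Proof.
move=> a0 ab; have est s t := @strip_estimate a b s t a0 ab.
have := rearr_nincr l acv vy a0 ab.
move: (rearr a) (rearr b) est => ra rb est.
have int0 : (0 <= \int[lambda]_(x in level `]rb, ra[) h x)%E.
  exact: integral_ge0.
have PP : 0 <= P b - P a by rewrite -lee_fin -mu_itv// mu_ge0.
rewrite le_eqVlt => /predU1P[->|ba].
  by rewrite subrr mulr0 adde_ge0 ?integral_ge0// lee_fin mulr_ge0.
apply/lee_addgt0Pr => e e0.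
pose A := a `^ k.
have D0 : 0 < ra - rb by rewrite subr_gt0.
have A0 : 0 < A by rewrite powR_gt0.
(* shrinking the strip by [d] on both sides loses [2 d A], which is at most [e] *)
pose d := Num.min ((ra - rb) / 4) (e / (2 * A)).
have d0 : 0 < d by rewrite lt_min !divr_gt0// mulr_gt0.
have d1 : d <= (ra - rb) / 4 by rewrite ge_min lexx.
have d2 : d * (2 * A) <= e.
  by rewrite -ler_pdivlMr ?mulr_gt0// ge_min lexx orbT.
have bs : rb < rb + d by rewrite ltrDl.
have ta : ra - d < ra by rewrite ltrBlDr ltrDl.
have st : rb + d < ra - d by lra.
have H := est _ _ bs st ta.
apply: (@le_trans _ _ ((A * (ra - d - (rb + d)))%:E + e%:E)%E).
  rewrite -EFinD lee_fin -/A.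
  rewrite (_ : d * (2 * A) = A * d + A * d) in d2; last by ring.
  rewrite !mulrBr !mulrDr; lra.
rewrite leeD2r// (le_trans H)// leeD2r//.
apply: ge0_subset_integral => //; [exact: measurable_level..| |].
  exact: measurable_funTS.
apply: level_sub => z; rewrite !in_itv/=; lra.
Qed.

End majorant.

End strip.

(** The open strip is an increasing union of strips to which [mu_level_le]
    applies. *)
Lemma mu_level_rearr (R : realType) (l : R) (v : R -> R) (a b : R) :
  0 < l + 1 -> loc_abs_continuous v -> v x @[x --> +oo] --> (0 : R) ->
  0 < a -> a <= b ->
  (mu l (level v `]rearr l v b, rearr l v a[) <=
     (pow_primitive l b - pow_primitive l a)%:E)%E.
Proof.
move=> l1 acv vy a0 ab; set P := pow_primitive l.
pose rb := rearr l v b; pose ra := rearr l v a.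
rewrite -/ra -/rb.
have : rb <= ra by exact: rearr_nincr.
rewrite le_eqVlt => /predU1P[->|ba].
  rewrite (_ : level v _ = set0); last first.
    by apply/seteqP; split => // x [_ /=]; rewrite in_itv/=; lra.
  by rewrite /mu integral_set0 -mu_itv// mu_ge0.
pose e n := (ra - rb) / 4 / n.+1%:R.
have e0 n : 0 < e n by rewrite !divr_gt0 ?subr_gt0.
have e4 n : e n <= (ra - rb) / 4.
  by rewrite ler_pdivrMr// ler_peMr ?ler1n// divr_ge0// subr_ge0 ltW.
pose F n := level v `]rb + e n, ra - e n].
have mF n : measurable (F n) by exact: measurable_level.
have ndF : nondecreasing_seq F.
  move=> n m nm; rewrite subsetEset; apply: level_sub => x; rewrite !in_itv/=.
  have : e m <= e n.
    by rewrite ler_pM2l ?divr_gt0 ?subr_gt0// lef_pV2 ?posrE// ler_nat.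
  lra.
have -> : level v `]rb, ra[ = \bigcup_n F n.
  apply/seteqP; split => x; last first.
    move=> [n _]; apply: level_sub => y; rewrite !in_itv/=.
    by have := e0 n; lra.
  move=> [x0 /=]; rewrite in_itv/= => /andP[bv va].
  pose d := Num.min (v x - rb) (ra - v x).
  have d0 : 0 < d by rewrite lt_min !subr_gt0 bv.
  have D0 : 0 < (ra - rb) / 4 by rewrite divr_gt0// subr_gt0.
  have := @near_infty_natSinv_lt R (PosNum (divr_gt0 d0 D0)).
  move=> [n _ /(_ n (leqnn _))/= nP].
  have : e n < d by rewrite /e -ltr_pdivlMl// mulrC.
  rewrite lt_min => /andP[? ?].
  by exists n => //; split => //=; rewrite in_itv/=; lra.
have : mu l (F n) @[n --> \oo] --> mu l (\bigcup_n F n).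
  apply: ge0_nondecreasing_set_cvg_integral => //.
  by move=> n; exact: measurable_norm_powR_EFin.
move=> /[dup] Fcvg /cvg_lim <-//.
apply: lime_le; first by apply/cvg_ex; eexists; exact: Fcvg.
apply: nearW => n; apply: mu_level_le => //; have := e0 n; have := e4 n.
- by rewrite -/rb; lra.
- by lra.
- by rewrite -/ra; lra.
Qed.

Lemma derive1_cvg (R : realType) (f : R -> R) (x : R) : derivable f x 1 ->
  (f (h + x) - f x) / h @[h --> 0^'] --> derive1 f x.
Proof.
move=> df; rewrite /derive1.
have -> : (fun h => h^-1 *: (f (h + x) - f x)) = (fun h => (f (h + x) - f x) / h).
  by apply/funext => h; rewrite mulrC.
have -> : (fun h => (f (h + x) - f x) / h) = (fun h => h^-1 *: (f (h *: (1:R) + x) - f x)).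
  by apply/funext => h; rewrite [_ *: 1]mulr1 mulrC.
exact: df.
Qed.

(** Off the countably many isolated points of the level set, the difference
    quotients vanish along a sequence. *)
Lemma ae_level_derive0 (R : realType) (v f : R -> R) (t : R) :
  {ae (@lebesgue_measure R),
     forall x, 0 < x -> derivable v x 1 /\ derive1 v x = f x} ->
  {ae (@lebesgue_measure R), forall x, level v `[t, t] x -> f x = 0}.
Proof.
move=> dv; pose K := level v `[t, t].
have cK : countable (isolated K) by exact: countable_isolated.
have isoK : {ae (@lebesgue_measure R), forall x, ~ isolated K x}.
  exists (isolated K); split; first exact: countable_measurable.
    exact: countable_lebesgue_measure0.
  by move=> x /=; rewrite notK.
apply: filterS2 dv isoK; first exact: (ae_filter_ringOfSetsType (@lebesgue_measure R)).
move=> x dvx nisoK [/=]; rewrite !in_itv/= andbT => x0 vx.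
have vxt : v x = t by apply/eqP; rewrite eq_le andbC.
have [dfx <-] := dvx x0.
apply: contrapT => /eqP f'0; apply: nisoK; split.
  by rewrite inE; split => /=; rewrite in_itv/= ?andbT.
have f'n0 : 0 < `|derive1 v x| by rewrite normr_gt0.
have := derive1_cvg dfx => /cvgrPdist_lt /(_ _ f'n0)[e /= e0 eP].
exists (ball x e); first exact: nbhsx_ballx.
apply/seteqP; split => [y [xye [y0 /=]]|_ ->]; last first.
  by split; [exact: ballxx|split => /=; rewrite in_itv/= ?andbT].
rewrite in_itv/= => vyt; have vy : v y = t by apply/eqP; rewrite eq_le andbC.
apply: contrapT => /eqP yx.
have := eP (y - x); rewrite /ball_/= sub0r normrN.
move: xye; rewrite /ball/= distrC => -> /(_ erefl).
by rewrite subr_eq0 subrK vy vxt subrr mul0r subr0 ltxx => /(_ yx).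
Qed.

(** * Energy of the strips *)

(** Truncating [F] at the height [N w] leaves an error with small integral. This
    is the absolute continuity of the integral of [F] with respect to the
    measure of density [w]. *)
Lemma integral_uniformly_le d (T : measurableType d) (R : realType)
    (mu : {measure set T -> \bar R}) (D : set T) (F w : T -> R) :
  measurable D -> measurable_fun setT F -> measurable_fun setT w ->
  (forall x, 0 <= F x) -> (forall x, D x -> 0 < w x) -> (forall x, 0 <= w x) ->
  (\int[mu]_(x in D) (F x)%:E < +oo)%E ->
  forall e : R, 0 < e -> exists N : nat, forall A, measurable A -> A `<=` D ->
    (\int[mu]_(x in A) (F x)%:E <= e%:E + N%:R%:E * \int[mu]_(x in A) (w x)%:E)%E.
Proof.
move=> mD mF mw F0 w0 w0' Foo e e0.
pose G (n : nat) := D `&` [set x | F x <= n%:R * w x].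
have mG n : measurable (G n).
  have : measurable_fun D (fun x => F x <= n%:R * w x).
    by apply: measurable_fun_ler; apply: measurable_funTS => //; exact: measurable_funM.
  by move=> /(_ mD [set true] Logic.I).
have mFA A : measurable_fun A (EFin \o F).
  by apply/measurable_EFinP; exact: measurable_funTS.
have mwA A : measurable_fun A (EFin \o w).
  by apply/measurable_EFinP; exact: measurable_funTS.
have ndG : nondecreasing_seq G.
  move=> n n' nn'; rewrite subsetEset => x [Dx /= Fx]; split => //=.
  by rewrite (le_trans Fx)// ler_wpM2r// ler_nat.
have DG : D = \bigcup_n G n.
  apply/seteqP; split => [x Dx|x [n _ []]//].
  exists (Num.bound (F x / w x)) => //; split => //=.
  by rewrite -ler_pdivrMr ?w0// ltW// archi_boundP// divr_ge0.
have : (\int[mu]_(x in G n) (F x)%:E)%E @[n --> \oo] -->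
    (\int[mu]_(x in D) (F x)%:E)%E.
  rewrite DG; apply: ge0_nondecreasing_set_cvg_integral => //.
  by move=> n x _; rewrite lee_fin.
have Ffin A : measurable A -> A `<=` D -> (\int[mu]_(x in A) (F x)%:E)%E \is a fin_num.
  move=> mA AD; rewrite ge0_fin_numE; last by apply: integral_ge0 => x _; rewrite lee_fin.
  apply: le_lt_trans Foo; apply: ge0_subset_integral => //.
  by move=> x _; rewrite lee_fin.
have GD n : G n `<=` D by exact: subIsetl.
move=> cvgG.
have [N NP] : exists N,
    (\int[mu]_(x in D) (F x)%:E - e%:E < \int[mu]_(x in G N) (F x)%:E)%E.
  apply: contrapT => /forallNP small.
  have : (\int[mu]_(x in D) (F x)%:E <= \int[mu]_(x in D) (F x)%:E - e%:E)%E.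
    rewrite -{1}(cvg_lim _ cvgG)//; apply: lime_le.
      by apply/cvg_ex; eexists; exact: cvgG.
    by apply: nearW => n; rewrite leNgt; apply/negP; exact: small.
  have := Ffin _ mD (@subset_refl _ _).
  case: (\int[mu]_(x in D) _)%E => // r _.
  by rewrite -EFinB lee_fin; lra.
exists N => A mA AD.
have AE : A = (A `&` G N) `|` (A `\` G N) by rewrite setUIDK.
have mAG := measurableI _ _ mA (mG N).
have mAG' := measurableD mA (mG N).
rewrite {1}AE ge0_integral_setU//; last 2 first.
  by move=> x _; rewrite lee_fin.
  by apply/disj_setPS => x [[_ Gx] [_ nGx]].
rewrite addeC leeD//.
  have DGE : (\int[mu]_(x in D) (F x)%:E =
      \int[mu]_(x in G N) (F x)%:E + \int[mu]_(x in D `\` G N) (F x)%:E)%E.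
    rewrite -ge0_integral_setU//.
    - by rewrite setDUK.
    - exact: measurableD.
    - by move=> x _; rewrite lee_fin.
    - by apply/disj_setPS => x [Gx [_ nGx]].
  apply: (@le_trans _ _ (\int[mu]_(x in D `\` G N) (F x)%:E)%E).
    apply: ge0_subset_integral => //.
    - exact: measurableD.
    - by move=> x _; rewrite lee_fin.
    - exact: setSD.
  move: NP; rewrite DGE.
  have := Ffin _ (mG N) (GD N).
  have := Ffin _ (measurableD mD (mG N)) (@subDsetl _ _ _).
  case: (\int[mu]_(x in G N) _)%E => // r; case: (\int[mu]_(x in D `\` _) _)%E => // r' _ _.
  by rewrite -!EFinD lte_fin lee_fin; lra.
apply: (@le_trans _ _ (\int[mu]_(x in A `&` G N) (N%:R%:E * (w x)%:E))%E).
  apply: ge0_le_integral_mono => x.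
    by rewrite lee_fin.
  by move=> [_ [_ /=]]; rewrite -EFinM lee_fin.
rewrite ge0_integralZl//; last by move=> x _; rewrite lee_fin.
rewrite lee_wpmul2l ?lee_fin//; apply: ge0_subset_integral => //.
by move=> x _; rewrite lee_fin.
Qed.

Lemma dominated_abs_continuous (R : realType) (a b C K : R) (f g : R -> R) :
  0 <= C -> 0 <= K -> abs_continuous a b f ->
  (forall x y, a <= x -> x <= y -> y <= b ->
    `|g y - g x| <= K * (`|f y - f x| + C * (y - x))) ->
  abs_continuous a b g.
Proof.
move=> C0 K0 acf fg e e0.
have e20 : 0 < e / (2 * (K + 1)) by rewrite divr_gt0// mulr_gt0//; lra.
have [d d0 dP] := acf _ e20.
have d20 : 0 < e / (2 * (K + 1)) / (C + 1) by rewrite divr_gt0//; lra.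
exists (Num.min d (e / (2 * (K + 1)) / (C + 1))); first by rewrite lt_min d0.
move=> n x y xy tI; rewrite lt_min => /andP[xyd].
rewrite ltr_pdivlMr; last lra.
move=> xyC; have := dP n x y xy tI xyd.
set S1 := \sum_(i < n) `|f (y i) - f (x i)|; move: xyC.
set S2 := \sum_(i < n) (y i - x i); set e' := e / _ => S2e S1e.
have S10 : 0 <= S1 by apply: sumr_ge0.
have S20 : 0 <= S2 by apply: sumr_ge0 => i _; have [_ [? _]] := xy i; rewrite subr_ge0.
apply: (@le_lt_trans _ _ (K * (S1 + C * S2))).
  rewrite /S1 /S2 [C * _]mulr_sumr -big_split/= mulr_sumr; apply: ler_sum => i _.
  by have [? [? ?]] := xy i; exact: fg.
have -> : e = (K + 1) * (e' + e') by rewrite /e'; field; lra.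
have : S1 + C * S2 < e' + e' by rewrite mulrDr mulr1 in S2e; lra.
move=> H; have H0 : 0 <= S1 + C * S2 by rewrite addr_ge0// mulr_ge0.
apply: (@le_lt_trans _ _ (K * (e' + e'))); first by rewrite ler_wpM2l// ltW.
rewrite mulrDl mul1r ltrDl; lra.
Qed.

Section level_energy.
Context {R : realType} (k l p m : R) (v f : R -> R).
Hypothesis k0 : 0 < k.
Hypothesis l1 : 0 < l + 1.
Hypothesis p1 : 1 <= p.
Hypothesis mE : m = p * k + (1 - p) * l.
Hypothesis acv : loc_abs_continuous v.
Hypothesis vy : v x @[x --> +oo] --> (0 : R).
Hypothesis mf : measurable_fun setT f.
Local Notation lambda := (@lebesgue_measure R).
Hypothesis dv : {ae lambda, forall x, 0 < x -> derivable v x 1 /\ derive1 v x = f x}.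
Hypothesis fE : forall a b, 0 < a -> a <= b ->
  lambda.-integrable `]a, b]%classic (EFin \o f) /\
  v b - v a = \int[lambda]_(t in `]a, b]) f t.
Local Notation P := (pow_primitive l).
Local Notation r := (rearr l v).
Local Notation level := (level v).
Let F (x : R) : R := `|f x| `^ p * `|x| `^ m.
Hypothesis Foo : (\int[lambda]_(x in `]0%R, +oo[) (F x)%:E < +oo)%E.

Let p_gt0 : 0 < p. Proof. exact: lt_le_trans ltr01 p1. Qed.

Let p_ge0 : 0 <= p. Proof. exact: ltW. Qed.

Let p1_ge0 : 0 <= p - 1. Proof. by rewrite subr_ge0. Qed.

Let F0 x : 0 <= F x.
Proof. by rewrite mulr_ge0 ?powR_ge0. Qed.

Let mF : measurable_fun setT F.
Proof.
apply: measurable_funM; last exact: measurable_norm_powR.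
exact: (measurableT_comp (measurable_norm_powR p) mf).
Qed.

Let mFA (A : set R) : measurable_fun A (EFin \o F).
Proof. by apply/measurable_EFinP; exact: measurable_funTS. Qed.

Let nu (A : set R) : \bar R := (\int[lambda]_(x in A) (F x)%:E)%E.

Let nu_ge0 A : (0 <= nu A)%E.
Proof. by apply: integral_ge0 => x _; rewrite lee_fin. Qed.

Let nu_le (A B : set R) : measurable A -> measurable B -> A `<=` B -> (nu A <= nu B)%E.
Proof.
move=> mA mB AB; apply: ge0_subset_integral => //; first exact: (@mFA _).
by move=> x _; rewrite lee_fin.
Qed.

Let nuU (A B : set R) : measurable A -> measurable B -> A `&` B = set0 ->
  nu (A `|` B) = (nu A + nu B)%E.
Proof.
move=> mA mB AB0; apply: ge0_integral_setU => //; first exact: (@mFA _).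
  by move=> x _; rewrite lee_fin.
by rewrite disj_set2E AB0.
Qed.

Let nu_fin I : nu (level I) \is a fin_num.
Proof.
rewrite ge0_fin_numE; last exact: nu_ge0.
apply: le_lt_trans Foo; apply: nu_le => //; first exact: measurable_level.
by move=> x [].
Qed.

Let nu_level1 t : nu (level `[t, t]) = 0%E.
Proof.
have mL : measurable (level `[t, t]) by exact: measurable_level.
rewrite -(integral0 lambda (level `[t, t])); apply: ge0_ae_eq_integral => //.
- exact: (@mFA _).
- by move=> x _; rewrite lee_fin.
apply: filterS (ae_level_derive0 t dv); first exact: (ae_filter_ringOfSetsType lambda).
have p0 : p != 0 by rewrite gt_eqF.
by move=> x H Lx; rewrite /F H// normr0 powR0// mul0r.
Qed.

(** The level [t] is left out because it carries no energy. *)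
Let nu_strip s t : s < t ->
  nu (level `]s, +oo[) = (nu (level `]s, t[) + nu (level `]t, +oo[))%E.
Proof.
move=> st; have mL I : measurable (level I) by exact: measurable_level.
have -> : level `]s, +oo[ = level `]s, t[ `|` level `[t, t] `|` level `]t, +oo[.
  apply/seteqP; split => x.
    move=> [x0 /=]; rewrite in_itv/= andbT => sx.
    have [vt|tv|vt] := ltgtP (v x) t.
    - by left; left; split => //=; rewrite in_itv/= sx.
    - by right; split => //=; rewrite in_itv/= tv.
    - by left; right; split => //=; rewrite in_itv/= vt lexx.
  by case=> [[|]|] -[x0 /=]; rewrite in_itv/=; split => //=; rewrite in_itv/=; lra.
rewrite !nuU//.
- by rewrite nu_level1 adde0.
- by apply/seteqP; split => // x [[_ /=]]; rewrite in_itv/= => H [_ /=]; rewrite in_itv/=; lra.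
- exact: measurableU.
- by apply/seteqP; split => // x [[[_ /=]|[_ /=]]]; rewrite in_itv/= => H [_ /=]; rewrite in_itv/=; lra.
Qed.

(** Its increments are the energies of the strips, which turns an inequality
    about strips into one about functions of [x] that can be differentiated. *)
Definition energy_above (x : R) : R :=
  fine (\int[lambda]_(y in level `]r x, +oo[) (`|f y| `^ p * `|y| `^ m)%:E).
Local Notation Phi := energy_above.

Lemma energy_aboveB a b : 0 < a -> a <= b ->
  (Phi b - Phi a)%:E = nu (level `]r b, r a[).
Proof.
move=> a0 ab; have := rearr_nincr l acv vy a0 ab.
rewrite /energy_above; move: (r a) (r b) => ra rb.
rewrite EFinB (fineK (nu_fin `]rb, +oo[)) (fineK (nu_fin `]ra, +oo[)).
rewrite -/(nu (level `]rb, +oo[)) -/(nu (level `]ra, +oo[)).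
rewrite le_eqVlt => /predU1P[->|ba].
  rewrite subee// (_ : level _ = set0) /nu ?integral_set0//.
  by apply/seteqP; split => // x [_ /=]; rewrite in_itv/=; lra.
by rewrite (nu_strip ba) addeK.
Qed.

Lemma energy_above_ndecr a b : 0 < a -> a <= b -> Phi a <= Phi b.
Proof.
by move=> a0 ab; rewrite -subr_ge0 -lee_fin energy_aboveB// nu_ge0.
Qed.

Lemma energy_above_le a b : 0 < a -> a <= b ->
  ((Phi b - Phi a)%:E <= \int[lambda]_(x in `]0%R, +oo[) (F x)%:E)%E.
Proof.
move=> a0 ab; rewrite energy_aboveB//; apply: nu_le => //.
  exact: measurable_level.
by move=> x [].
Qed.

Let strip_strip0 s t s' t' : t <= s' ->
  level `]s, t[ `&` level `]s', t'[ = set0.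
Proof.
move=> ts'; apply/seteqP; split => // z [[_ /=]]; rewrite in_itv/= => H [_ /=].
by rewrite in_itv/=; lra.
Qed.

Let strips_disjoint a (n : nat) (x y : 'I_n -> R) : 0 < a ->
  (forall i, a <= x i /\ x i <= y i) ->
  trivIset setT (fun i => `]x i, y i[%classic) ->
  trivIset setT (fun i => level `]r (y i), r (x i)[).
Proof.
move=> a0 xy /trivIsetP tI; apply/trivIsetP => i j _ _ ij.
have xyE (q : 'I_n) : x q = y q \/ x q < y q.
  by have [_] := xy q; rewrite le_eqVlt => /predU1P.
have empty s t : level `]s, s[ `&` t = set0.
  by apply/seteqP; split => // z [[_ /=]]; rewrite in_itv/=; lra.
have [axi _] := xy i; have [axj _] := xy j.
have [-> //|xyi] := xyE i; have [->|xyj] := xyE j.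
  by rewrite setIC; exact: empty.
have [yx|yx] := disjoint_oo_itv xyi xyj (tI i j Logic.I Logic.I ij).
- by rewrite setIC strip_strip0//; exact: rearr_nincr (lt_trans (lt_le_trans a0 axi) xyi) yx.
- by rewrite strip_strip0//; exact: rearr_nincr (lt_trans (lt_le_trans a0 axj) xyj) yx.
Qed.

(** Strips over disjoint intervals are disjoint and of small total weight, and
    the energy is absolutely continuous with respect to the weight. *)
Lemma energy_above_abs_continuous : loc_abs_continuous Phi.
Proof.
move=> a b a0 ab e e0; have e20 : 0 < e / 2 by rewrite divr_gt0.
have [C C0 CP] := pow_primitive_lipschitz l1 b a0.
have w0 x : `]0, +oo[%classic x -> 0 < `|x| `^ l.
  by rewrite /= in_itv/= andbT => x0; rewrite powR_gt0// normr_gt0 gt_eqF.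
have [N NP] := @integral_uniformly_le _ _ R lambda `]0, +oo[%classic F
  (fun x => `|x| `^ l) (measurable_itv _) mF (measurable_norm_powR l) F0 w0 (fun x => powR_ge0 _ _) Foo _ e20.
exists (e / 2 / (N%:R * C + 1)).
  by rewrite divr_gt0// ltr_wpDl// mulr_ge0.
move=> n x y xy tI; rewrite ltr_pdivlMr ?ltr_wpDl ?mulr_ge0//.
set S := \sum_(i < n) (y i - x i) => Se.
have S0 : 0 <= S by apply: sumr_ge0 => i _; have [_ [? _]] := xy i; rewrite subr_ge0.
pose W i := level `]r (y i), r (x i)[.
have mW i : measurable (W i) by exact: measurable_level.
have tW : trivIset [set` index_enum 'I_n] W.
  apply: sub_trivIset (strips_disjoint a0 _ tI) => //.
  by move=> i; have [? [? _]] := xy i.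
have mU : measurable (\big[setU/set0]_(i < n) W i) by exact: bigsetU_measurable.
have UW : \big[setU/set0]_(i < n) W i `<=` `]0, +oo[.
  by rewrite -bigcup_seq => z [i _ []].
have NU := NP _ mU UW.
rewrite -lte_fin; apply: (@le_lt_trans _ _ (nu (\big[setU/set0]_(i < n) W i))).
  rewrite /nu ge0_integral_bigsetU ?index_enum_uniq//; last 2 first.
    exact: (@mFA _).
    by move=> z _; rewrite lee_fin.
  rewrite -sumEFin; apply: lee_sum => i _; have [axi [xyi yib]] := xy i.
  have xi0 := lt_le_trans a0 axi.
  rewrite ger0_norm ?subr_ge0 ?energy_above_ndecr//.
  by rewrite energy_aboveB.
apply: (le_lt_trans NU).
rewrite ge0_integral_bigsetU ?index_enum_uniq//; last exact: (@measurable_norm_powR_EFin _ _ _).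
apply: (@le_lt_trans _ _ ((e / 2)%:E + N%:R%:E * (C * S)%:E)%E).
  rewrite leeD2l// lee_wpmul2l ?lee_fin// /S mulr_sumr -sumEFin.
  apply: lee_sum => i _; have [axi [xyi yib]] := xy i.
  have xi0 := lt_le_trans a0 axi.
  apply: le_trans (mu_level_rearr l1 acv vy xi0 xyi) _.
  by rewrite lee_fin CP.
rewrite -EFinM -EFinD lte_fin.
move: Se; rewrite mulrDr mulr1 => Se.
have -> : N%:R * (C * S) = S * (N%:R * C) by ring.
have := S0; move: (S * (N%:R * C)) Se => Z; move: (S) => s; lra.
Qed.

(** [rearr_decrease_le] for the tangent form of Young's inequality with slope
    at [L]. *)
Lemma rearr_young a b L : 0 < a -> a <= b -> 0 <= L ->
  p * L `^ (p - 1) * (a `^ k * (r a - r b)) <=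
    Phi b - Phi a + (p - 1) * L `^ p * (P b - P a).
Proof.
move=> a0 ab L0.
have PP : 0 <= P b - P a by rewrite -lee_fin -mu_itv// mu_ge0.
have q0 : 0 <= p * L `^ (p - 1) by rewrite mulr_ge0 ?powR_ge0.
have c0 : 0 <= (p - 1) * L `^ p by rewrite mulr_ge0 ?powR_ge0.
move: q0; rewrite le_eqVlt => /predU1P[<-|q0].
  by rewrite mul0r; apply: addr_ge0; [rewrite subr_ge0 energy_above_ndecr|exact: mulr_ge0].
set q := p * L `^ (p - 1) in q0 *; set c := (p - 1) * L `^ p in c0 *.
have q'0 : 0 <= q^-1 by rewrite invr_ge0 ltW.
have mh : measurable_fun setT (fun x => (q^-1)%:E * (F x)%:E)%E.
  by apply: measurable_funeM; exact: (@mFA _).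
have h0 x : (0 <= (q^-1)%:E * (F x)%:E)%E by rewrite -EFinM lee_fin mulr_ge0.
have cq0 : 0 <= q^-1 * c by rewrite mulr_ge0.
have fh x : 0 < x ->
    ((`|f x| * x `^ k)%:E <= (q^-1)%:E * (F x)%:E + (q^-1 * c * x `^ l)%:E)%E.
  move=> x0; rewrite -EFinM -EFinD lee_fin -mulrA -mulrDr ler_pdivlMl//.
  have g0 : 0 <= `|f x| * x `^ (k - l) by rewrite mulr_ge0 ?powR_ge0.
  have := young_tangent p1 g0 L0; rewrite -/q -/c.
  rewrite -(ler_pM2r (powR_gt0 l x0)) mulrDl -!mulrA -powRD; last by rewrite (gt_eqF x0) implybT.
  rewrite subrK powRM ?powR_ge0// -powRrM -mulrA -powRD; last by rewrite (gt_eqF x0) implybT.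
  rewrite /F (gtr0_norm x0) mE.
  by have -> : (k - l) * p + l = p * k + (1 - p) * l by ring.
have := rearr_decrease_le l1 acv vy mf fE (ltW k0) cq0 mh h0 fh a0 ab.
rewrite ge0_integralZl//; last 3 first.
  exact: measurable_level.
  exact: (@mFA _).
  by move=> z _; rewrite lee_fin.
rewrite -/(nu _) -energy_aboveB// -EFinM -EFinD lee_fin.
rewrite -mulrA -mulrDr ler_pdivlMl//.
Qed.

(** [rearr_young] with [L = 1] bounds the increments of [rearr] by those of
    [energy_above] and of the primitive of the weight. *)
Lemma rearr_abs_continuous : loc_abs_continuous r.
Proof.
move=> a b a0 ab.
have [C C0 CP] := pow_primitive_lipschitz l1 b a0.
apply: (@dominated_abs_continuous _ _ _ ((p - 1) * C) (p * a `^ k)^-1 Phi).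
- by rewrite mulr_ge0.
- by rewrite invr_ge0 mulr_ge0 ?powR_ge0.
- exact: energy_above_abs_continuous.
move=> x y ax xy yb; have x0 := lt_le_trans a0 ax.
rewrite ler_pdivlMl; last by rewrite mulr_gt0 ?powR_gt0.
rewrite distrC ger0_norm ?subr_ge0 ?rearr_nincr//.
rewrite ger0_norm ?subr_ge0 ?energy_above_ndecr//.
have := rearr_young x0 xy ler01; rewrite !powR1 !mulr1.
have H : (p - 1) * (P y - P x) <= (p - 1) * C * (y - x).
  by rewrite -mulrA ler_wpM2l ?CP.
have H2 : a `^ k * (r x - r y) <= x `^ k * (r x - r y).
  rewrite ler_wpM2r ?subr_ge0 ?rearr_nincr//.
  by rewrite ge0_ler_powR ?nnegrE// ltW.
move=> H3; rewrite -[p * _ * _]mulrA.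
apply: le_trans (ler_wpM2l p_ge0 H2) (le_trans H3 _).
by rewrite lerD2l.
Qed.

End level_energy.

(** * Comparison of the energies *)

Lemma is_derive_ge0_right (R : realType) (f : R -> R) (x f' : R) :
  is_derive x 1 f f' -> (forall y, x < y -> f x <= f y) -> 0 <= f'.
Proof.
move=> [/derive1_cvg + <-] fx; rewrite -derive1E => df.
rewrite leNgt; apply/negP => f'0.
have f'n : 0 < - derive1 f x by rewrite oppr_gt0.
have [e /= e0 eP] := (cvgrPdist_lt _ _).1 df _ f'n.
have e20 : 0 < e / 2 by rewrite divr_gt0.
have := eP (e / 2); rewrite /ball_/= sub0r normrN gtr0_norm// gtr_pMr// invf_lt1// ltr1n.
rewrite gt_eqF// => /(_ isT isT).
have : 0 <= (f (e / 2 + x) - f x) / (e / 2).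
  by rewrite divr_ge0 ?(ltW e20)// subr_ge0 fx// ltrDr.
move: ((f (e / 2 + x) - f x) / (e / 2)) => q q0.
by rewrite distrC ger0_norm; lra.
Qed.

(** Differentiating the hypothesis at [x] bounds [derive1 Phi x] below for every
    slope [L]; the best choice is [L = |derive1 r x| * x `^ (k - l)]. *)
Lemma derive1_young_le (R : realType) (k l p m x : R) (r Phi : R -> R) :
  0 < l + 1 -> 1 <= p -> m = p * k + (1 - p) * l -> 0 < x ->
  derivable r x 1 -> derivable Phi x 1 -> (forall y, x < y -> r y <= r x) ->
  (forall y L, x < y -> 0 <= L ->
    p * L `^ (p - 1) * (x `^ k * (r x - r y)) <=
    Phi y - Phi x + (p - 1) * L `^ p * (pow_primitive l y - pow_primitive l x)) ->
  `|derive1 r x| `^ p * `|x| `^ m <= derive1 Phi x.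
Proof.
move=> l1 p1 mE x0 dr dPhi rx young; pose P := pow_primitive l.
have p0 : 0 < p by exact: lt_le_trans ltr01 p1.
have Dr : is_derive x 1 r (derive1 r x).
  exact: (DeriveDef _ (esym (derive1E _ _))).
have DPhi : is_derive x 1 Phi (derive1 Phi x).
  exact: (DeriveDef _ (esym (derive1E _ _))).
have r'0 : 0 <= - derive1 r x.
  apply: (is_derive_ge0_right (is_deriveN Dr)) => y xy.
  by rewrite lerN2; exact: rx.
pose L := - derive1 r x * x `^ (k - l).
have L0 : 0 <= L by rewrite mulr_ge0 ?powR_ge0.
pose q := p * L `^ (p - 1) * x `^ k.
pose c := (p - 1) * L `^ p.
have DH := is_deriveD (is_deriveD DPhi (is_deriveZ c (is_derive_pow_primitive l1 x0)))
  (is_deriveZ q Dr).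
have : 0 <= derive1 Phi x + c * x `^ l + q * derive1 r x.
  apply: (is_derive_ge0_right DH) => y xy.
  have := young y L xy L0; rewrite -/c -/P [p * _ * (_ * _)]mulrA -/q.
  change (q * (r x - r y) <= Phi y - Phi x + c * (P y - P x) ->
    Phi x + c * P x + q * r x <= Phi y + c * P y + q * r y).
  move: (r x) (r y) (Phi x) (Phi y) (P x) (P y) => ? ? ? ? ? ?.
  by rewrite !mulrBr; lra.
have qE : q * - derive1 r x = p * (L `^ p * x `^ l).
  have -> : q * - derive1 r x = p * (L `^ (p - 1) * L * x `^ l).
    have xk : x `^ k = x `^ (k - l) * x `^ l.
      by rewrite -powRD ?subrK// (gt_eqF x0) implybT.
    by rewrite /q xk /L; ring.
  congr (_ * (_ * _)); move: L0; rewrite le_eqVlt => /predU1P[<-|L0].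
    by rewrite mulr0 powR0// gt_eqF.
  by rewrite -[X in _ * X]powRr1 ?ltW// -powRD ?subrK// (gt_eqF L0) implybT.
have LE : L `^ p * x `^ l = `|derive1 r x| `^ p * `|x| `^ m.
  rewrite (gtr0_norm x0) -normrN (ger0_norm r'0) /L powRM ?powR_ge0// -powRrM.
  rewrite -mulrA -powRD; last by rewrite (gt_eqF x0) implybT.
  by rewrite mE; congr (_ * _ `^ _); ring.
rewrite -LE; move: qE; rewrite /c mulrN -[_ * _ * x `^ l]mulrA.
by move: (L `^ p * x `^ l) (q * _) (derive1 Phi x) => A B C; lra.
Qed.

Section rearr_energy.
Context {R : realType} (k l p m : R) (v f : R -> R).
Hypothesis k0 : 0 < k.
Hypothesis l1 : 0 < l + 1.
Hypothesis p1 : 1 <= p.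
Hypothesis mE : m = p * k + (1 - p) * l.
Hypothesis acv : loc_abs_continuous v.
Hypothesis vy : v x @[x --> +oo] --> (0 : R).
Hypothesis mf : measurable_fun setT f.
Local Notation lambda := (@lebesgue_measure R).
Hypothesis dv : {ae lambda, forall x, 0 < x -> derivable v x 1 /\ derive1 v x = f x}.
Hypothesis fE : forall a b, 0 < a -> a <= b ->
  lambda.-integrable `]a, b]%classic (EFin \o f) /\
  v b - v a = \int[lambda]_(t in `]a, b]) f t.
Local Notation P := (pow_primitive l).
Local Notation r := (rearr l v).
Local Notation Phi := (energy_above l p m v f).
Hypothesis Foo : (\int[lambda]_(x in `]0%R, +oo[)
  (`|f x| `^ p * `|x| `^ m)%:E < +oo)%E.

Lemma energy_rearr_le :
  (energy p m r <= \int[lambda]_(x in `]0%R, +oo[)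
    (`|f x| `^ p * `|x| `^ m)%:E)%E.
Proof.
set E := (X in (_ <= X)%E).
have acr := rearr_abs_continuous k0 l1 p1 mE acv vy mf dv fE Foo.
have acPhi := energy_above_abs_continuous l1 p1 acv vy mf dv Foo.
have PhiE a b := energy_above_le l p1 acv vy mf dv Foo (a := a) (b := b).
have [rho [_ drho _]] := loc_abs_continuous_density acr.
have [phi [mphi dphi phiE]] := loc_abs_continuous_density acPhi.
(* [phi] is nonnegative only almost everywhere *)
pose psi x := Num.max 0 (phi x).
have mpsi : measurable_fun setT psi by exact: measurable_maxr.
have psi0 x : 0 <= psi x by rewrite le_max lexx.
have rphi : {ae lambda, forall x, 0 < x ->
    `|derive1 r x| `^ p * `|x| `^ m <= phi x}.
  apply: filterS2 drho dphi; first exact: (ae_filter_ringOfSetsType lambda).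
  move=> x drx dphix x0; have [dr _] := drx x0; have [dPhi <-] := dphix x0.
  apply: (derive1_young_le l1 p1 mE x0 dr dPhi).
    by move=> y xy; exact: (rearr_nincr l acv vy x0 (ltW xy)).
  by move=> y L xy L0; exact: (rearr_young k0 l1 p1 mE acv vy mf dv fE Foo x0 (ltW xy) L0).
have psiphi : {ae lambda, forall x, 0 < x -> psi x = phi x}.
  apply: filterS rphi; first exact: (ae_filter_ringOfSetsType lambda).
  move=> x H x0; apply: max_r; apply: le_trans (H x0).
  by rewrite mulr_ge0 ?powR_ge0.
have psi_itv a b : 0 < a -> a <= b ->
    (\int[lambda]_(x in `]a, b]) (psi x)%:E <= E)%E.
  move=> a0 ab; have [iphi phiab] := phiE a b a0 ab.
  apply: le_trans (PhiE a b a0 ab); rewrite phiab /Rintegral fineK; last first.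
    exact: integrable_fin_num.
  rewrite le_eqVlt; apply/orP; left; apply/eqP; apply: ae_eq_integral => //.
  - by apply/measurable_EFinP; exact: measurable_funTS.
  - by apply/measurable_EFinP; exact: measurable_funTS.
  apply: filterS psiphi; first exact: (ae_filter_ringOfSetsType lambda).
  move=> x H; rewrite /= in_itv/= => /andP[ax _]; rewrite H//.
  exact: lt_trans ax.
pose I (n : nat) := `]n.+1%:R^-1, n.+1%:R]%classic : set R.
have ndI : nondecreasing_seq I.
  move=> n n' nn'; rewrite subsetEset => x; rewrite /I /= !in_itv/=.
  have : n'.+1%:R^-1 <= n.+1%:R^-1 :> R by rewrite lef_pV2 ?posrE// ler_nat.
  have : n.+1%:R <= n'.+1%:R :> R by rewrite ler_nat.
  by move=> h1 h2 /andP[/(le_lt_trans h2) -> /le_trans ->].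
have IE : `]0, +oo[%classic = \bigcup_n I n.
  apply/seteqP; split => x; last first.
    move=> [n _]; rewrite /I /= !in_itv/= andbT => /andP[+ _].
    by apply: lt_trans; rewrite invr_gt0.
  rewrite /= in_itv/= andbT => x0.
  have : \forall n \near \oo, I n x.
    near=> n; rewrite /I /= in_itv/=; apply/andP; split.
      by near: n; exact: near_infty_natSinv_lt (PosNum x0).
    rewrite (@le_trans _ _ n%:R) ?ler_nat//.
    by near: n; exact: nbhs_infty_ger.
  by move=> [n _ /(_ n (leqnn _)) ?]; exists n.
have psiE : (\int[lambda]_(x in `]0%R, +oo[) (psi x)%:E <= E)%E.
  have : (\int[lambda]_(x in I n) (psi x)%:E)%E @[n --> \oo] -->
      (\int[lambda]_(x in \bigcup_n I n) (psi x)%:E)%E.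
    apply: ge0_nondecreasing_set_cvg_integral => //.
    - by move=> n; exact: measurable_itv.
    - by move=> n; apply/measurable_EFinP; exact: measurable_funTS.
    - by move=> n x _; rewrite lee_fin.
  rewrite -IE => /[dup] cvgI /cvg_lim <-//.
  apply: lime_le; first by apply/cvg_ex; eexists; exact: cvgI.
  apply: nearW => n; apply: psi_itv; first by rewrite invr_gt0.
  by rewrite (@le_trans _ _ 1)// ?invf_le1// ?ler1n.
apply: le_trans psiE; apply: ae_ge0_le_integralr => //.
- by apply/measurable_EFinP; exact: measurable_funTS.
- by move=> x _; rewrite lee_fin.
apply: filterS2 rphi psiphi; first exact: (ae_filter_ringOfSetsType lambda).
move=> x H1 H2; rewrite /= in_itv/= andbT => x0.
by rewrite lee_fin H2// H1.
Unshelve. all: by end_near. Qed.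

End rearr_energy.

Lemma le_norm_derive1 (R : realType) (v u : R -> R) (x : R) :
  derivable v x 1 -> derivable u x 1 ->
  (forall y, `|v y - v x| <= `|u y - u x|) -> `|derive1 v x| <= `|derive1 u x|.
Proof.
move=> /derive1_cvg/cvg_norm dv /derive1_cvg/cvg_norm du vu.
apply: ler_cvg_to dv du _; apply: nearW => h.
by rewrite !normrM ler_wpM2r.
Qed.

Lemma half_symmetrizationE (R : realType) (l : R) (u : R -> R) :
  half_symmetrization l u = rearr l (fun x => `|u x|).
Proof.
have levelE t : 0 <= t -> [set y | t < `|(u \_ `]0, +oo[) y|] =
    level (fun x => `|u x|) `]t, +oo[.
  move=> t0; apply/seteqP; split => y /=; rewrite patchE.
    case: ifPn => [/set_mem y0 tu|_]; first by split => //=; rewrite in_itv/= tu.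
    by rewrite normr0 ltNge t0.
  by move=> [y0 /=]; rewrite in_itv/= andbT mem_set.
apply/funext => x; rewrite /half_symmetrization /rearr; congr sup.
by apply/seteqP; split => t /= [t0]; rewrite levelE.
Qed.

Theorem theorem3p2 (R : realType) (k l p m : R)
    (hk : 0 < k) (hkl : k <= l + 1) (hp : 1 <= p)
    (hm : m = p * k + (1 - p) * l)
    (u : R -> R) (hu : in_W p m l u) :
  loc_abs_continuous (half_symmetrization l u) /\
  (energy p m (half_symmetrization l u) <= energy p m u)%E.
Proof.
have l1 : 0 < l + 1 by exact: lt_le_trans hkl.
case: hu => acu _ Eu uy.
rewrite half_symmetrizationE; set v := fun x => `|u x|.
have vu x y : `|v y - v x| <= `|u y - u x| by exact: ler_dist_dist.
have acv : loc_abs_continuous v.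
  move=> a b a0 ab; apply: (@dominated_abs_continuous _ _ _ 0 1 u) => //.
    exact: acu.
  by move=> x y _ _ _; rewrite mul1r mul0r addr0.
have vy : v x @[x --> +oo] --> (0 : R).
  by rewrite -(normr0 R); exact: cvg_norm.
have [f [mf dv fE]] := loc_abs_continuous_density acv.
have [g [_ du _]] := loc_abs_continuous_density acu.
have vE : (\int[lebesgue_measure]_(x in `]0%R, +oo[)
    (`|f x| `^ p * `|x| `^ m)%:E <= energy p m u)%E.
  apply: ae_ge0_le_integrall => //.
  - apply/measurable_EFinP/measurable_funTS/measurable_funM.
      exact: (measurableT_comp (measurable_norm_powR p) mf).
    exact: measurable_norm_powR.
  apply: filterS2 dv du; first exact: (ae_filter_ringOfSetsType lebesgue_measure).
  move=> x dvx dux; rewrite /= in_itv/= andbT => x0.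
  have [{}dvx <-] := dvx x0; have [{}dux _] := dux x0.
  rewrite lee_fin; apply: ler_wpM2r; first exact: powR_ge0.
  apply: ge0_ler_powR; rewrite ?nnegrE ?normr_ge0 ?(le_trans ler01 hp)//.
  exact: (le_norm_derive1 dvx dux (fun y => vu x y)).
have Foo := le_lt_trans vE Eu.
split; first exact: (rearr_abs_continuous hk l1 hp hm acv vy mf dv fE Foo).
exact: le_trans (energy_rearr_le hk l1 hp hm acv vy mf dv fE Foo) vE.
Qed.
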